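(* Let $d\in\{2,3\}$ and let $\Omega\subset\mathbb{R}^d$ be a bounded Lipschitz domain which is homeomorphic to a ball. Let $0\le\chi\in L^\infty(\Omega)$, and let $U:\Omega\times\mathbb{R}^d\to(-\infty,\infty]$ be measurable and such that for almost all $x\in\Omega$ the function $U(x,\cdot)$ is proper, closed, $\sigma$-strongly convex and two times continuously differentiable on its domain, with $\sigma>0$ independent of $x$. Let $\mathbf{j_s}=\operatorname{curl}\mathbf{H_s}$ for some $\mathbf{H_s}\in H(\operatorname{curl};\Omega)$. Let $\mathcal{T}_h=\{T\}$ be a geometrically conforming simplicial partition of $\Omega$, and assume that $\chi$, $U$, and $\mathbf{H_s}$ are piecewise continuous functions in space with respect to the partition $\mathcal{T}_h$. Then the problem: find $\psi_h\in V_h$ such that $$(\nabla_{\mathbf{H}}w^*(\mathbf{H_s}-\nabla\psi_h),\nabla v_h)_h=0\qquad\forall v_h\in V_h,$$ admits a unique solution, which is equivalently characterized as the unique minimizer of $$\min_{v_h\in V_h}(w^*(\mathbf{H_s}-\nabla v_h),1)_h.$$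
   Context: Here $\mathbf{j_s}$ is the current density, $\mathbf{H_s}$ a source field, $\mu_0>0$ the permeability of vacuum, and $\mathbf{J}_p$ (with values in $\mathbb{R}^d$, depending on $x\in\Omega$) the given previous state of the magnetic polarization. The co-energy density is $$w^*(x,\mathbf{H})=\frac{\mu_0}{2}|\mathbf{H}|^2-\inf_{\mathbf{J}\in\mathbb{R}^d}\{U(x,\mathbf{J})-\langle\mathbf{H},\mathbf{J}\rangle+\chi(x)|\mathbf{J}-\mathbf{J}_p(x)|\};$$ its dependence on $x$ is suppressed in the claim, and $\nabla_{\mathbf{H}}w^*$ is the gradient with respect to $\mathbf{H}$. $V_h=\{v_h\in H^1(\Omega):\int_\Omega v_h\,dx=0,\ v_h|_T\in P_1(T)\ \forall T\in\mathcal{T}_h\}$ is the space of continuous piecewise linear finite element functions with zero integral, and $(\mathbf{u}_h,\mathbf{v}_h)_h=\sum_{T\in\mathcal{T}_h}\mathbf{u}_h(x_T)\cdot\mathbf{v}_h(x_T)\,|T|$, where $x_T$ and $|T|$ are the barycenter and the area (volume) of the element $T$. A function $f:\mathbb{R}^d\to(-\infty,\infty]$ is closed if its epigraph is closed; its domain is $\{f<\infty\}$; it is proper if its domain is nonempty; it is $\sigma$-strongly convex if $f-\frac{\sigma}{2}|\cdot|^2$ is convex. $H(\operatorname{curl};\Omega)$ is the space of fields in $L^2(\Omega)^d$ whose weak curl is square integrable.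
   Formalization: The formal theorem additionally assumes that U(x_T,·) is proper at every barycenter x_T; ''almost all x'' and piecewise continuity do not give this: for U = 1/|x−x_T| + |J|² (with +∞ at x_T), w*(x_T,·) is identically −∞ and has no gradient. *)

(* Defs.v *)
From HB Require Import structures.
From mathcomp Require Import all_boot all_order all_algebra.
From mathcomp Require Import all_classical all_reals all_analysis.
From mathcomp Require Import measurable_realfun.
Set Implicit Arguments.
Unset Strict Implicit.
Unset Printing Implicit Defensive.
Import Order.TTheory GRing.Theory Num.Theory.
Import numFieldNormedType.Exports.
Local Open Scope classical_set_scope.
Local Open Scope ring_scope.

(* Borel sigma-algebra on matrices, generated by the entries as is done for
   tuples in the library. *)
Definition coord_system {R : realType} {m n : nat} : set (set 'M[R]_(m, n)) :=
  [set B | exists i j (A : set R),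
     measurable A /\ B = (fun M : 'M[R]_(m, n) => M i j) @^-1` A].

Definition mx_display : measure_display. Proof. exact: default_measure_display. Qed.

Section mx_measurable.
Context {R : realType} {m n : nat}.
Let mx0 : <<s @coord_system R m n >> set0.
Proof. exact: sigma_algebra0. Qed.
Let mxC (A : set 'M[R]_(m, n)) :
  <<s coord_system >> A -> <<s coord_system >> (~` A).
Proof. exact: sigma_algebraC. Qed.
Let mxU (F : (set 'M[R]_(m, n))^nat) :
  (forall i, <<s coord_system >> (F i)) -> <<s coord_system >> (\bigcup_i F i).
Proof. exact: sigma_algebra_bigcup. Qed.
HB.instance Definition _ := @isMeasurable.Build mx_display
  'M[R]_(m, n) <<s coord_system >> mx0 mxC mxU.
End mx_measurable.

Definition cons_rV {R : realType} {n : nat} (p : R * 'rV[R]_n) : 'rV[R]_n.+1 :=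
  row_mx (p.1%:M : 'rV[R]_1) p.2.

Definition uncons_rV {R : realType} {n : nat} (x : 'rV[R]_n.+1) : R * 'rV[R]_n :=
  (x 0 ord0, \row_j x 0 (lift ord0 j)).

Lemma cons_rV0 {R : realType} n (p : R * 'rV[R]_n) : cons_rV p 0 ord0 = p.1.
Proof.
rewrite /cons_rV mxE; case: splitP => // j _.
by rewrite ord1 mxE eqxx.
Qed.

Lemma cons_rVS {R : realType} n (p : R * 'rV[R]_n) (j : 'I_n) :
  cons_rV p 0 (lift ord0 j) = p.2 0 j.
Proof.
have -> : lift ord0 j = rshift 1 j by exact: val_inj.
exact: row_mxEr.
Qed.

Lemma cons_rVK {R : realType} n : cancel (@cons_rV R n) uncons_rV.
Proof.
move=> [a y]; rewrite /uncons_rV cons_rV0; congr pair.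
by apply/rowP => j; rewrite mxE cons_rVS.
Qed.

Lemma uncons_rVK {R : realType} n : cancel (@uncons_rV R n) cons_rV.
Proof.
move=> x; apply/rowP => j; case: (unliftP ord0 j) => [k ->|->].
  by rewrite cons_rVS mxE.
by rewrite cons_rV0.
Qed.

Lemma measurable_coord {R : realType} m n i j :
  measurable_fun setT (fun M : 'M[R]_(m, n) => M i j).
Proof.
move=> _ A mA; rewrite setTI.
by apply: sub_sigma_algebra; exists i, j, A.
Qed.

Lemma measurable_mx {R : realType} d (T : measurableType d) m n
    (f : T -> 'M[R]_(m, n)) :
  (forall i j, measurable_fun setT (fun t => f t i j)) -> measurable_fun setT f.
Proof.
move=> mf; apply: (@measurability _ _ _ _ setT f coord_system) => //.
move=> _ [_ [i [j [A [mA ->]]]] <-].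
rewrite -comp_preimage; exact: mf.
Qed.

Lemma measurable_cons_rV {R : realType} n :
  measurable_fun setT (@cons_rV R n).
Proof.
apply: measurable_mx => i j; rewrite ord1.
case: (unliftP ord0 j) => [k ->|->].
  under eq_fun do rewrite cons_rVS.
  exact: measurableT_comp (measurable_coord _ _) measurable_snd.
under eq_fun do rewrite cons_rV0.
exact: measurable_fst.
Qed.

Lemma measurable_uncons_rV {R : realType} n :
  measurable_fun setT (@uncons_rV R n).
Proof.
apply/measurable_fun_pairP; split; first exact: measurable_coord.
apply: measurable_mx => i j.
under eq_fun do rewrite /= mxE.
exact: measurable_coord.
Qed.

Section lebesgue_step.
Context {R : realType} {n : nat}.
Variable mu : {sigma_finite_measure set 'rV[R]_n -> \bar R}.

Definition lebesgue_step : set 'rV[R]_n.+1 -> \bar R :=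
  pushforward (@lebesgue_measure R \x mu)%E cons_rV.

Let step0 : lebesgue_step set0 = 0%E.
Proof. by rewrite /lebesgue_step /pushforward preimage_set0 measure0. Qed.
Let step_ge0 A : (0 <= lebesgue_step A)%E.
Proof. by rewrite /lebesgue_step /pushforward; apply: measure_ge0. Qed.
Let step_sigma_additive : semi_sigma_additive lebesgue_step.
Proof.
move=> F mF tF mUF; rewrite /lebesgue_step /pushforward preimage_bigcup.
have mp A : measurable A -> measurable (@cons_rV R n @^-1` A).
  by move=> mA; rewrite -[X in measurable X]setTI; exact: measurable_cons_rV.
apply: measure_semi_sigma_additive.
- by move=> k; exact: mp.
- apply/trivIsetP => /= i j _ _ ij; rewrite -preimage_setI.
  by move/trivIsetP : tF => /(_ _ _ _ _ ij) ->//; rewrite preimage_set0.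
- by rewrite -preimage_bigcup; exact: mp.
Qed.
HB.instance Definition _ := isMeasure.Build _ _ _ lebesgue_step
  step0 step_ge0 step_sigma_additive.

Let step_sigma_finite : sigma_finite setT lebesgue_step.
Proof.
have /sigma_finiteP[F [TF ndF Foo]] := sigma_finiteT (@lebesgue_measure R).
have /sigma_finiteP[G [TG ndG Goo]] := sigma_finiteT mu.
exists (fun k => @uncons_rV R n @^-1` (F k `*` G k)).
  apply/esym; rewrite -subTset => x _.
  have : [set: measurableTypeR R] (uncons_rV x).1 by [].
  rewrite TF => -[i _ Fi].
  have : [set: 'rV[R]_n] (uncons_rV x).2 by [].
  rewrite TG => -[j _ Gj].
  exists (maxn i j) => //; split.
    by move: Fi; exact/subsetPset/ndF/leq_maxl.
  by move: Gj; exact/subsetPset/ndG/leq_maxr.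
move=> k; have [? ?] := Foo k; have [? ?] := Goo k; split.
  rewrite -[X in measurable X]setTI; apply: measurable_uncons_rV => //.
  exact: measurableX.
rewrite /lebesgue_step /pushforward -comp_preimage.
rewrite (_ : uncons_rV \o cons_rV = idfun); last exact/funext/cons_rVK.
by rewrite product_measure1E// lte_mul_pinfty// ge0_fin_numE.
Qed.
HB.instance Definition _ := Measure_isSigmaFinite.Build _ _ _ lebesgue_step
  step_sigma_finite.
End lebesgue_step.

(* d-dimensional Lebesgue measure; lebesgue_rV_box gives its value on boxes. *)
Fixpoint lebesgue_rV (R : realType) (n : nat) :
    {sigma_finite_measure set 'rV[R]_n -> \bar R} :=
  match n with
  | 0 => \d_(0 : 'rV[R]_0)
  | n'.+1 => lebesgue_step (lebesgue_rV R n')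
  end.

Lemma lebesgue_rV_box (R : realType) n (A : 'I_n -> set R) :
  (forall i, measurable (A i)) ->
  lebesgue_rV R n [set x | forall i, A i (x 0 i)] =
  (\prod_(i < n) (@lebesgue_measure R (A i)))%E.
Proof.
elim: n A => [|n IH] A mA.
  rewrite big_ord0 /= diracE mem_set//= => i; by case: i.
have mB : measurable [set y : 'rV[R]_n | forall i, A (lift ord0 i) (y 0 i)].
  rewrite (_ : [set y | _] = \bigcap_(i in [set: 'I_n])
      (fun y : 'rV[R]_n => y 0 i) @^-1` A (lift ord0 i)); last first.
    by apply/seteqP; split=> y /= h i; [move=> _; exact: h|exact: h].
  apply: fin_bigcap_measurable => // i _.
  by rewrite -[X in measurable X]setTI; apply: measurable_coord.
rewrite big_ord_recl -IH//= /lebesgue_step /pushforward -product_measure1E//.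
congr (_ _); apply/seteqP; split=> [[a y]|[a y]] /=.
  move=> h; split; first by have := h ord0; rewrite cons_rV0.
  by move=> i; have := h (lift ord0 i); rewrite cons_rVS.
move=> [h1 h2] i; case: (unliftP ord0 i) => [k ->|->].
  by rewrite cons_rVS; exact: h2.
  by rewrite cons_rV0.
exact: mA.
Qed.

Section euclidean.
Context {R : realType} {d : nat}.

Definition dotp (u v : 'rV[R]_d) : R := \sum_i u 0 i * v 0 i.

(* The library norm on row vectors is the sup norm. *)
Definition enorm (u : 'rV[R]_d) : R := Num.sqrt (dotp u u).

Definition grad (f : 'rV[R]_d -> R) (x : 'rV[R]_d) : 'rV[R]_d :=
  \row_i 'D_(delta_mx 0 i) (f : 'rV[R]_d -> R^o) x.

Fixpoint Ck_on (k : nat) (W : set 'rV[R]_d) (f : 'rV[R]_d -> R) : Prop :=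
  {within W, continuous f} /\
  match k with
  | 0 => True
  | k'.+1 => forall i : 'I_d,
      (forall x, W x -> derivable (f : 'rV[R]_d -> R^o) x (delta_mx 0 i)) /\
      Ck_on k' W ('D_(delta_mx 0 i) (f : 'rV[R]_d -> R^o))
  end.

End euclidean.

Section domains.
Context {R : realType} {d : nat}.
Implicit Types Om A B : set 'rV[R]_d.

Definition bounded_domain Om : Prop :=
  [/\ open Om, connected Om, Om !=set0 & bounded_set Om].

(* Near each boundary point, after the change of orthonormal coordinates
   x |-> x *m Q, the set is the strict epigraph of a Lipschitz function of the
   coordinates other than the k-th. *)
Definition lipschitz_boundary Om : Prop :=
  forall p : 'rV[R]_d, closure Om p -> ~ Om p ->
  exists (r : R) (Q : 'M[R]_d) (k : 'I_d) (g : 'rV[R]_d.-1 -> R^o),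
    [/\ 0 < r, Q *m Q^T = 1%:M, exists L : R, L.-lipschitz g &
        forall x : 'rV[R]_d, enorm (x - p) < r ->
          (Om x <-> g (col' k (x *m Q)) < (x *m Q) 0 k)].

Definition homeomorphic A B : Prop :=
  exists f g : 'rV[R]_d -> 'rV[R]_d,
    [/\ {within A, continuous f}, {within B, continuous g},
        forall x, A x -> B (f x) /\ g (f x) = x &
        forall y, B y -> A (g y) /\ f (g y) = y].

Definition unit_ball : set 'rV[R]_d := [set x | enorm x < 1].

End domains.

(* The curl is scalar in two dimensions and vectorial in three; its k-th
   component is d_a F_b - d_b F_a for (a, b) = curl_pair d k (0-based). *)
Definition curl_dim (d : nat) : nat := if d == 2%N then 1%N else 3%N.

Definition curl_pair (d k : nat) : nat * nat :=
  if d == 2%N then (0, 1)%N else ((k + 1) %% 3, (k + 2) %% 3)%N.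

Section function_spaces.
Context {R : realType} {d : nat}.
Variable Om : set 'rV[R]_d.
Notation leb := (lebesgue_rV R d).

(* Lebesgue measurability on Om, that is, almost everywhere equality with a
   Borel function. *)
Definition ae_measurable d' (T : measurableType d') (f : 'rV[R]_d -> T) : Prop :=
  exists2 g : 'rV[R]_d -> T, measurable_fun Om g &
    {ae leb, forall x, Om x -> f x = g x}.

Definition L2_on (f : 'rV[R]_d -> R) : Prop :=
  ae_measurable (f : 'rV[R]_d -> measurableTypeR R) /\
  (\int[leb]_(x in Om) ((f x) ^+ 2)%:E < +oo)%E.

Definition Linfty_on (f : 'rV[R]_d -> R) : Prop :=
  ae_measurable (f : 'rV[R]_d -> measurableTypeR R) /\
  exists C : R, {ae leb, forall x, Om x -> `|f x| <= C}.

Definition L2_vec_on m (F : 'rV[R]_d -> 'rV[R]_m) : Prop :=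
  forall i, L2_on (fun x => F x 0 i).

Definition test_function (phi : 'rV[R]_d -> R) : Prop :=
  (forall k, Ck_on k setT phi) /\
  exists K : set 'rV[R]_d,
    [/\ compact K, K `<=` Om & forall x, ~ K x -> phi x = 0].

Definition weak_gradient (v : 'rV[R]_d -> R) (G : 'rV[R]_d -> 'rV[R]_d) : Prop :=
  forall (i : 'I_d) phi, test_function phi ->
    \int[leb]_(x in Om) (v x * grad phi x 0 i)
    = - \int[leb]_(x in Om) (G x 0 i * phi x).

Definition H1_on (v : 'rV[R]_d -> R) : Prop :=
  L2_on v /\ exists2 G, L2_vec_on G & weak_gradient v G.

Definition weak_curl (F : 'rV[R]_d -> 'rV[R]_d)
    (j : 'rV[R]_d -> 'rV[R]_(curl_dim d)) : Prop :=
  forall (k : 'I_(curl_dim d)) (a b : 'I_d),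
    curl_pair d k = (nat_of_ord a, nat_of_ord b) ->
  forall phi, test_function phi ->
    \int[leb]_(x in Om) (F x 0 b * grad phi x 0 a - F x 0 a * grad phi x 0 b)
    = - \int[leb]_(x in Om) (j x 0 k * phi x).

(* F belongs to H(curl; Om) and j is its curl. *)
Definition Hcurl_on (F : 'rV[R]_d -> 'rV[R]_d)
    (j : 'rV[R]_d -> 'rV[R]_(curl_dim d)) : Prop :=
  [/\ L2_vec_on F, L2_vec_on j & weak_curl F j].

End function_spaces.

Section extended_convex.
Context {R : realType} {d : nat}.
Implicit Types f : 'rV[R]_d -> \bar R.

Definition edom f : set 'rV[R]_d := [set J | (f J < +oo)%E].

Definition proper_fun f : Prop := edom f !=set0.

Definition closed_fun f : Prop :=
  closed [set p : 'rV[R]_d * R | (f p.1 <= p.2%:E)%E].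

Definition econvex f : Prop :=
  forall (J K : 'rV[R]_d) (t : R), 0 <= t <= 1 ->
    (f (t *: J + (1 - t) *: K)%R <= t%:E * f J + (1 - t)%:E * f K)%E.

Definition strongly_convex (sigma : R) f : Prop :=
  econvex (fun J => f J - (sigma / 2 * enorm J ^+ 2)%:E)%E.

(* On a domain that need not be open, twice continuously differentiable means
   having a C^2 extension to an open neighbourhood. *)
Definition C2_on_dom f : Prop :=
  exists (W : set 'rV[R]_d) (g : 'rV[R]_d -> R),
    [/\ open W, edom f `<=` W, Ck_on 2 W g & forall J, edom f J -> f J = (g J)%:E].

(* w^*(x, H) *)
Definition coenergy (mu0 : R) (chi : 'rV[R]_d -> R) (Jp : 'rV[R]_d -> 'rV[R]_d)
    (U : 'rV[R]_d -> 'rV[R]_d -> \bar R) (x H : 'rV[R]_d) : \bar R :=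
  ((mu0 / 2 * enorm H ^+ 2)%:E -
   ereal_inf [set U x J - (dotp H J)%:E + (chi x * enorm (J - Jp x))%:E
             | J in setT])%E.

End extended_convex.

Section mesh.
Context {R : realType} {d : nat}.

Definition hull_of (v : 'I_d.+1 -> 'rV[R]_d) (P : set 'I_d.+1) : set 'rV[R]_d :=
  [set x | exists l : 'I_d.+1 -> R,
     [/\ forall a, 0 <= l a, \sum_a l a = 1, forall a, ~ P a -> l a = 0 &
         x = \sum_a l a *: v a]].

Definition simplex (v : 'I_d.+1 -> 'rV[R]_d) : set 'rV[R]_d := hull_of v setT.

Definition barycenter (v : 'I_d.+1 -> 'rV[R]_d) : 'rV[R]_d :=
  d.+1%:R^-1 *: \sum_a v a.

Definition volume (v : 'I_d.+1 -> 'rV[R]_d) : R :=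
  fine (lebesgue_rV R d (simplex v)).

Definition affinely_independent (v : 'I_d.+1 -> 'rV[R]_d) : Prop :=
  forall c : 'I_d.+1 -> R, \sum_a c a = 0 -> \sum_a c a *: v a = 0 ->
    forall a, c a = 0.

Variables (Om : set 'rV[R]_d) (I : finType) (T : I -> 'I_d.+1 -> 'rV[R]_d).

(* Elements are closed nondegenerate simplices given by their vertices, and two
   of them meet in the hull of their common vertices (empty if there are none). *)
Definition conforming_partition : Prop :=
  [/\ forall i, affinely_independent (T i),
      injective (fun i => simplex (T i)),
      closure Om = \bigcup_i simplex (T i) &
      forall i j, simplex (T i) `&` simplex (T j) =
        hull_of (T i) [set a | exists b, T i a = T j b]].

(* For an extended-valued f, continuity refers to the topology of \bar R. *)
Definition piecewise_continuous (S : topologicalType) (f : 'rV[R]_d -> S) : Prop :=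
  forall i, {within interior (simplex (T i)), continuous f}.

(* The continuous representatives of the finite element functions, which are
   determined by their values on Om. *)
Definition Vh (v : 'rV[R]_d -> R) : Prop :=
  [/\ H1_on Om v, {within Om, continuous v},
      \int[lebesgue_rV R d]_(x in Om) v x = 0 &
      forall i, exists (a : R) (b : 'rV[R]_d),
        forall x, simplex (T i) x -> Om x -> v x = a + dotp b x].

Definition ip_h (u v : 'rV[R]_d -> 'rV[R]_d) : R :=
  \sum_i dotp (u (barycenter (T i))) (v (barycenter (T i))) * volume (T i).

Definition quad_h (f : 'rV[R]_d -> \bar R) : \bar R :=
  (\sum_i f (barycenter (T i)) * (volume (T i))%:E)%E.

Definition finite_differentiable (f : 'rV[R]_d -> \bar R) (H : 'rV[R]_d) : Prop :=
  (\forall K \near H, f K \is a fin_num) /\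
  differentiable (fine \o f : 'rV[R]_d -> R^o) H.

(* The gradients in the variational equation are required to exist. *)
Definition solves_discrete (w : 'rV[R]_d -> 'rV[R]_d -> \bar R)
    (Hs : 'rV[R]_d -> 'rV[R]_d) (psi : 'rV[R]_d -> R) : Prop :=
  [/\ Vh psi,
      forall i, let x := barycenter (T i) in
        finite_differentiable (w x) (Hs x - grad psi x) &
      forall v, Vh v ->
        ip_h (fun x => grad (fine \o w x) (Hs x - grad psi x)) (grad v) = 0].

Definition minimizes_discrete (w : 'rV[R]_d -> 'rV[R]_d -> \bar R)
    (Hs : 'rV[R]_d -> 'rV[R]_d) (psi : 'rV[R]_d -> R) : Prop :=
  Vh psi /\ forall v, Vh v ->
    (quad_h (fun x => w x (Hs x - grad psi x)%R)
     <= quad_h (fun x => w x (Hs x - grad v x)%R))%E.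

End mesh.

Definition unique_on {R : realType} {d : nat} (Om : set 'rV[R]_d)
    (P : ('rV[R]_d -> R) -> Prop) (psi : 'rV[R]_d -> R) : Prop :=
  P psi /\ forall phi, P phi -> forall x, Om x -> phi x = psi x.

(* Main.v *)
Require Import Defs.
From HB Require Import structures.
From mathcomp Require Import all_boot all_order all_algebra.
From mathcomp Require Import all_classical all_reals all_analysis.
From mathcomp Require Import measurable_realfun.
From mathcomp Require Import ring lra.
Set Implicit Arguments.
Unset Strict Implicit.
Unset Printing Implicit Defensive.
Import Order.TTheory GRing.Theory Num.Theory.
Import numFieldNormedType.Exports.
Local Open Scope classical_set_scope.
Local Open Scope ring_scope.

(* At a fixed point [x] where [U x] is proper and strongly convex, [w^*(x, .)] is
   [mu0 / 2 |H|^2] plus the conjugate of a strongly convex function, and it stays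
   between two parabolas around its tangent: the lower one comes from [mu0], the
   upper one from the strong convexity of [U x].  The minimum in the conjugate need
   not be attained, since at a barycenter only strong convexity and [0 <= chi]
   survive the passage to the limit from almost every nearby point (closedness and
   smoothness do not); the gradient is the limit of the minimizing sequences, which
   are Cauchy.  The lower parabola makes the discrete functional strongly convex in
   the tuple of element gradients.  These tuples form a linear, hence closed, space,
   so the same Cauchy argument gives a unique minimizing tuple; a function of [V_h]
   is determined by its gradients because [Om] is connected and the mean is zero.
   The two parabolas show that the variational equation and minimality are
   equivalent.  No integration by parts is needed: only the linearity of [V_h]
   enters. *)

(** * Minimizing sequences and spans *)

(** The gain [c] in the midpoint inequality forces near-minimizers to be close to each other, so the
    sets of near-minimizers generate a Cauchy filter. Its limit [z] may lie outside [D], which is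
    why the growth is measured from the infimum [mn] and not from [F z]. *)
Lemma midconvex_minimizing_limit (R : realType) m n (D : set 'M[R]_(m, n))
    (F : 'M[R]_(m, n) -> R) (c M : R) :
    0 < c -> D !=set0 ->
    (forall J K, D J -> D K -> D (2^-1 *: (J + K)) /\
       F (2^-1 *: (J + K)) <= (F J + F K) / 2 - c * `|J - K| ^+ 2) ->
    (forall J, D J -> M <= F J) ->
  exists mn z, (forall J, D J -> mn + 2 * c * `|J - z| ^+ 2 <= F J) /\
    (forall e, 0 < e -> exists2 J, D J & F J < mn + e /\ `|z - J| < e).
Proof.
move=> c0 [J0 DJ0] mid lbF.
have hinf : has_inf (F @` D).
  split; first by exists (F J0), J0.
  by exists M => _ [J DJ <-]; exact: lbF.
pose mn := inf (F @` D).
have mnF J : D J -> mn <= F J by move=> DJ; apply: ge_inf; [case: hinf|exists J].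
pose A e := [set J | D J /\ F J < mn + e].
pose G := filter_from [set e : R | 0 < e] A.
have GP : ProperFilter G.
  apply: filter_from_proper; last first.
    move=> e e0; have [_ [J DJ <-] FJ] := inf_adherent e0 hinf.
    by exists J; split.
  apply: filter_from_filter; first by exists 1 => /=.
  move=> e e' e0 e'0; exists (Num.min e e'); first by rewrite /= lt_min; apply/andP.
  by move=> J [DJ]; rewrite -ltrBlDl lt_min !ltrBlDl => /andP[h1 h2]; split.
have Gc : cauchy G.
  apply: cauchy_exP => e e0.
  have ce0 : 0 < c * e ^+ 2 by rewrite mulr_gt0// exprn_gt0.
  have [_ [J DJ <-] FJ] := inf_adherent ce0 hinf.
  exists J; exists (c * e ^+ 2) => // K [DK FK].
  rewrite -ball_normE /=.
  have [DM FM] := mid _ _ DJ DK; have := mnF _ DM => mM.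
  rewrite -/mn in FJ.
  have : c * `|J - K| ^+ 2 < c * e ^+ 2 by lra.
  by rewrite ltr_pM2l// ltr_pXn2r// ?nnegrE// ltW.
have /cvg_ex[/= z Gz] := @cauchy_cvg _ G GP Gc.
have near e : 0 < e -> exists2 J, D J & F J < mn + e /\ `|z - J| < e.
  move=> e0.
  have h1 : G (A e) by exists e.
  have h2 : G (ball z e) by apply: Gz; exact: nbhsx_ballx.
  have [J [[DJ FJ] bJ]] := filter_ex (filterI h1 h2).
  by exists J => //; split=> //; move: bJ; rewrite -ball_normE.
exists mn, z; split=> // J DJ; rewrite leNgt; apply/negP => lt.
set a := `|J - z| in lt.
have a0 : 0 <= a by rewrite normr_ge0.
set dl := mn + 2 * c * a ^+ 2 - F J.
have dl0 : 0 < dl by rewrite /dl subr_gt0.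
have den0 : 0 < 1 + 4 * c * a by rewrite ltr_pwDl// !mulr_ge0// ltW.
(* If [F J] misses the growth bound by [dl], the midpoint of [J] and of a [K] close to [z] yields
   [dl <= e * (1 + 4 * c * a)]. This [e] makes the right side [dl / 2]. *)
pose e := dl / (2 * (1 + 4 * c * a)).
have e0 : 0 < e by rewrite divr_gt0// mulr_gt0.
have [K DK [FK zK]] := near _ e0.
have [DM FM] := mid _ _ DJ DK; have mM := mnF _ DM.
have tri : a <= `|J - K| + e.
  rewrite /a (_ : J - z = (J - K) - (z - K)); last by rewrite opprB addrA subrK.
  by apply: le_trans (ler_normB _ _) _; rewrite lerD2l ltW.
have sq : a ^+ 2 - 2 * a * e <= `|J - K| ^+ 2.
  have := normr_ge0 (J - K); move: tri; set b := `|J - K| => tri b0.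
  have [ae|ea] := leP a e; first nra.
  have : (a - e) ^+ 2 <= b ^+ 2.
    by rewrite ler_pXn2r// ?nnegrE ?lerBlDr// subr_ge0 ltW.
  nra.
have ee : e * (2 * (1 + 4 * c * a)) = dl by rewrite /e divfK// gt_eqF// mulr_gt0.
have : c * (a ^+ 2 - 2 * a * e) <= c * `|J - K| ^+ 2 by rewrite ler_pM2l.
have : 0 <= e * (1 + 4 * c * a) by apply: mulr_ge0; apply: ltW.
rewrite /dl in ee dl0; nra.
Qed.

(* Take a matrix of maximal rank among those with rows in [S]. *)
Lemma row_span_of_set (F : fieldType) n (S : set 'rV[F]_n) :
  exists m (A : 'M[F]_(m, n)), (forall i, S (row i A)) /\
    forall y, S y -> (y <= A)%MS.
Proof.
pose P r := `[< exists m (A : 'M[F]_(m, n)), (forall i, S (row i A)) /\ \rank A = r >].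
have P0 : exists r, P r.
  by exists 0%N; apply/asboolP; exists 0%N, 0; split; [case|rewrite mxrank0].
have Pn r : P r -> (r <= n)%N.
  by move=> /asboolP[m [A [_ <-]]]; exact: rank_leq_col.
case: (ex_maxnP P0 Pn) => r /asboolP[m [A [SA rA]]] rmax.
exists m, A; split=> // y Sy.
have rS : P (\rank (col_mx y A)).
  apply/asboolP; exists (1 + m)%N, (col_mx y A); split=> // i.
  case: (split_ordP i) => j ->; last by rewrite rowKd.
  by rewrite rowKu ord1 (_ : row 0 y = y)//; apply/rowP => k; rewrite mxE.
have : (\rank (col_mx y A) <= \rank A)%N by rewrite rA; exact: rmax.
rewrite -addsmxE => h.
have := mxrank_leqif_sup (addsmxSr y A) => -[h1 h2].
have : (y + A <= A)%MS by rewrite -h2 eqn_leq h1 h.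
by rewrite addsmx_sub => /andP[].
Qed.

(** * Euclidean product and convex functions *)

Section dotp_theory.
Context {R : realType} {d : nat}.
Implicit Types u v w : 'rV[R]_d.

Lemma dotpC u v : dotp u v = dotp v u.
Proof. by apply: eq_bigr => i _; rewrite mulrC. Qed.

Lemma dotpDl u v w : dotp (u + v) w = dotp u w + dotp v w.
Proof. by rewrite /dotp -big_split; apply: eq_bigr => i _; rewrite mxE mulrDl. Qed.

Lemma dotpZl a u w : dotp (a *: u) w = a * dotp u w.
Proof. by rewrite /dotp mulr_sumr; apply: eq_bigr => i _; rewrite mxE mulrA. Qed.

Lemma dotpDr u v w : dotp w (u + v) = dotp w u + dotp w v.
Proof. by rewrite dotpC dotpDl !(dotpC w). Qed.

Lemma dotpZr a u w : dotp w (a *: u) = a * dotp w u.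
Proof. by rewrite dotpC dotpZl (dotpC w). Qed.

Lemma dotpNl u w : dotp (- u) w = - dotp u w.
Proof. by rewrite -scaleN1r dotpZl mulN1r. Qed.

Lemma dotpNr u w : dotp w (- u) = - dotp w u.
Proof. by rewrite dotpC dotpNl (dotpC w). Qed.

Definition dotpE := (dotpDl, dotpDr, dotpNl, dotpNr, dotpZl, dotpZr).

Lemma dotp_delta v i : dotp v (delta_mx 0 i) = v 0 i.
Proof.
rewrite /dotp (bigD1 i)//= big1 ?addr0 ?mxE ?eqxx ?mulr1// => j ji.
by rewrite mxE (negbTE ji) andbF mulr0.
Qed.

Lemma mx_entry_le m n (M : 'M[R]_(m, n)) i j : `|M i j| <= `|M|.
Proof.
rewrite [leRHS]/Num.norm/= mx_normrE; apply/bigmax_geP; right => /=.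
by exists (i, j).
Qed.

Lemma mx_norm_le m n (M : 'M[R]_(m, n)) (a : R) :
  0 <= a -> (forall i j, `|M i j| <= a) -> `|M| <= a.
Proof.
move=> a0 Ma; rewrite [leLHS]/Num.norm/= mx_normrE; apply/bigmax_leP; split=> //.
Qed.

Lemma dotp_ge0 u : 0 <= dotp u u.
Proof. by apply: sumr_ge0 => i _; rewrite -expr2 sqr_ge0. Qed.

Lemma sqr_enorm u : enorm u ^+ 2 = dotp u u.
Proof. by rewrite sqr_sqrtr// dotp_ge0. Qed.

(** Here [|u|] is the sup norm, which carries the topology of row vectors; hence the factor [d]. *)
Lemma dotp_bound u v : `|dotp u v| <= d%:R * `|u| * `|v|.
Proof.
apply: le_trans (ler_norm_sum _ _ _) _.
apply: (@le_trans _ _ (\sum_(i < d) `|u| * `|v|)).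
  by apply: ler_sum => i _; rewrite normrM ler_pM ?mx_entry_le.
by rewrite sumr_const card_ord -[leLHS]mulr_natl mulrA.
Qed.

Lemma sqr_norm_le_dotp u : `|u| ^+ 2 <= dotp u u.
Proof.
have [u0|] := eqVneq (mx_norm u) 0.
  by rewrite [`|u|]u0 expr0n/= dotp_ge0.
move=> /mx_norm_neq0[[i j]] /=; rewrite ord1 => {i} uj.
rewrite [`|u|]uj -normrX ger0_norm ?sqr_ge0// /dotp (bigD1 j)//= expr2 lerDl.
by apply: sumr_ge0 => i _; rewrite -expr2 sqr_ge0.
Qed.

Lemma dotp_eq0 u : dotp u u = 0 -> u = 0.
Proof.
move=> u0; apply/eqP; rewrite -normr_eq0 -sqrf_eq0 eq_le sqr_ge0 andbT -u0.
exact: sqr_norm_le_dotp.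
Qed.

(** Cauchy-Schwarz: expand the squared length of [enorm v *: u - enorm u *: v] and divide by twice
    the product of the lengths. *)
Lemma dotp_le_enorm u v : dotp u v <= enorm u * enorm v.
Proof.
have [u0|u0] := eqVneq (enorm u) 0.
  have /dotp_eq0 -> : dotp u u = 0 by rewrite -sqr_enorm u0 expr0n.
  by rewrite /dotp big1 ?mulr_ge0 ?sqrtr_ge0// => i _; rewrite mxE mul0r.
have [v0|v0] := eqVneq (enorm v) 0.
  have /dotp_eq0 -> : dotp v v = 0 by rewrite -sqr_enorm v0 expr0n.
  by rewrite /dotp big1 ?mulr_ge0 ?sqrtr_ge0// => i _; rewrite mxE mulr0.
have uv0 : 0 < enorm u * enorm v by rewrite mulr_gt0// lt_def ?u0 ?v0 sqrtr_ge0.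
have := dotp_ge0 (enorm v *: u - enorm u *: v).
rewrite !dotpE (dotpC v u) -!sqr_enorm; set a := enorm u in uv0 *.
set b := enorm v in uv0 * => h.
rewrite -(ler_pM2l uv0); nra.
Qed.

Lemma enorm_convex u v t : 0 <= t <= 1 ->
  enorm (t *: u + (1 - t) *: v) <= t * enorm u + (1 - t) * enorm v.
Proof.
move=> /andP[t0 t1]; have t1' : 0 <= 1 - t by rewrite subr_ge0.
have u0 : 0 <= enorm u := sqrtr_ge0 _; have v0 : 0 <= enorm v := sqrtr_ge0 _.
have r0 : 0 <= t * enorm u + (1 - t) * enorm v by rewrite addr_ge0// mulr_ge0.
rewrite -(@ler_pXn2r _ 2)// ?nnegrE ?sqrtr_ge0// sqr_enorm !dotpE (dotpC v u).
have := dotp_le_enorm u v => h.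
have : t * (1 - t) * dotp u v <= t * (1 - t) * (enorm u * enorm v).
  by rewrite ler_wpM2l// mulr_ge0.
rewrite -!sqr_enorm; nra.
Qed.

End dotp_theory.

Definition convex_on (R : realType) d (D : set 'rV[R]_d) (f : 'rV[R]_d -> R) :=
  forall J K t, D J -> D K -> 0 <= t <= 1 ->
    D (t *: J + (1 - t) *: K) /\
    f (t *: J + (1 - t) *: K) <= t * f J + (1 - t) * f K.

(** * Lower bounds and conjugates of convex functions *)

Section convex_bounds.
Context {R : realType} {d : nat}.

(** The weight missing from [tau] is given to the point [0] of [L]. Carrying the total [tau] through
    the induction confines the normalization to the last step. *)
Lemma convex_set_sum (L : set 'rV[R]_d) (I : eqType) (a : I -> 'rV[R]_d)
    (l : I -> R) (r : seq I) (tau : R) :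
    (forall J K t, L J -> L K -> 0 <= t <= 1 -> L (t *: J + (1 - t) *: K)) ->
    L 0 -> (forall i, L (a i)) -> (forall i, 0 <= l i) ->
    \sum_(i <- r) l i <= tau ->
  exists2 p, L p & \sum_(i <- r) l i *: a i = tau *: p.
Proof.
move=> cL L0 La l0; elim: r tau => [|i r IH] tau.
  by rewrite !big_nil => _; exists 0; rewrite ?scaler0.
rewrite !big_cons => h.
have sum0 : 0 <= \sum_(j <- r) l j by apply: sumr_ge0.
have [|p Lp ->] := IH (tau - l i); first by lra.
have [tau0|tau0] := eqVneq tau 0.
  have li0 : l i = 0 by have := l0 i; lra.
  by exists 0; rewrite // tau0 li0 subr0 !scale0r addr0.
have taup : 0 < tau by rewrite lt_def tau0; have := l0 i; lra.
exists ((l i / tau) *: a i + (1 - l i / tau) *: p).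
  apply: cL => //; rewrite divr_ge0 ?l0 ?(ltW taup)//= ler_pdivrMr// mul1r; lra.
by rewrite scalerDr !scalerA mulrBr mulr1 mulrCA divff// mulr1.
Qed.

(* [D] has a point [c] in the middle of a maximal simplex of [D]; [c] is a convex
   combination of [y] and of a point of that simplex, where [f] is bounded above, and
   the weight of [y] decays at most like [1 / (1 + `|y|)]. *)
Lemma convex_on_lower_bound (D : set 'rV[R]_d) (f : 'rV[R]_d -> R) :
  convex_on D f -> exists2 C, 0 <= C & forall y, D y -> - C * (1 + `|y|) <= f y.
Proof.
move=> cf; have [[x0 Dx0]|noD] := pselect (D !=set0); last first.
  by exists 0 => // y Dy; exfalso; apply: noD; exists y.
pose S := [set z | D (x0 + z)]; pose g z := f (x0 + z).
have cg : convex_on S g.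
  move=> J K t SJ SK t01; have := cf _ _ _ SJ SK t01; rewrite /S /g /=.
  suff -> : t *: (x0 + J) + (1 - t) *: (x0 + K) = x0 + (t *: J + (1 - t) *: K) by [].
  by rewrite !scalerDr addrACA -scalerDl (_ : t + (1 - t) = 1) ?scale1r//; ring.
have S0 : S 0 by rewrite /S /= addr0.
(* [D] may have empty interior, so the argument runs in the span of the translate [S], generated by
   points of [S] that are the rows of [A]. *)
have [m [A [SA AS]]] := row_span_of_set S.
pose M : R := `|g 0| + \sum_i `|g (row i A)|.
have M0 : 0 <= M by rewrite addr_ge0// sumr_ge0.
pose L := [set z | S z /\ g z <= M].
have cL J K t : L J -> L K -> 0 <= t <= 1 -> L (t *: J + (1 - t) *: K).
  move=> [SJ gJ] [SK gK] t01; have [h1 h2] := cg _ _ _ SJ SK t01; split=> //.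
  move: t01 => /andP[t0 t1]; nra.
have L0 : L 0.
  by split=> //; apply: le_trans (ler_norm _) _; rewrite lerDl sumr_ge0.
have La i : L (row i A).
  split=> //; apply: le_trans (ler_norm _) _; rewrite /M (bigD1 i)//= addrCA.
  by rewrite lerDl addr_ge0// sumr_ge0.
(* [N] counts the rows of [A] together with [0]; all of them get the weight [N^-1] in the middle
   point [c]. *)
have [N [NE N0]] : exists N : R, N = m.+1%:R /\ 0 < N.
  by exists m.+1%:R; rewrite ltr0n.
have [c [Sc gc] cE] : exists2 c, L c & \sum_i N^-1 *: row i A = 1 *: c.
  apply: convex_set_sum => //.
    by move=> _; rewrite invr_ge0 ltW.
  rewrite sumr_const card_ord -[leLHS]mulr_natl ler_pdivrMr// mul1r NE ler_nat.
  exact: leqnSn.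
rewrite scale1r in cE.
pose K : R := \sum_i \sum_j `|pinvmx A i j|.
have K0 : 0 <= K by rewrite sumr_ge0// => i _; rewrite sumr_ge0.
pose B : R := `|g c| + M.
have B0 : 0 <= B by rewrite addr_ge0.
have key z : S z -> - (B * (2 * N)) * (1 + K * `|z|) <= g z.
  move=> Sz; pose w := z *m pinvmx A.
  have zE : \sum_i w 0 i *: row i A = z by rewrite -mulmx_sum_row mulmxKpV// AS.
  pose W : R := 1 + \sum_i `|w 0 i|.
  have wsum : 0 <= \sum_i `|w 0 i| by rewrite sumr_ge0.
  have W1 : 1 <= W by rewrite lerDl.
  have WK : W <= 1 + K * `|z|.
    rewrite lerD2l /K exchange_big/= mulr_suml; apply: ler_sum => i _.
    rewrite mxE; apply: le_trans (ler_norm_sum _ _ _) _.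
    rewrite mulr_suml; apply: ler_sum => j _.
    by rewrite normrM mulrC ler_wpM2l// mx_entry_le.
  have W0 : 0 < W by apply: lt_le_trans W1.
  (* [s] is the weight of [z] in [c]. Since [s * W] is half of [N^-1], the remaining weights
     [N^-1 - s * w 0 i] are nonnegative and sum to at most [1 - s]. *)
  pose s : R := (2 * N * W)^-1.
  have den0 : 0 < 2 * N * W by rewrite !mulr_gt0.
  have s0 : 0 < s by rewrite invr_gt0.
  have sW : s * W = N^-1 / 2 by rewrite /s; field; rewrite !gt_eqF.
  have Ni0 : 0 < N^-1 by rewrite invr_gt0.
  have Ni1 : N^-1 <= 1 by rewrite invf_le1// NE ler1n.
  have s12 : s <= 2^-1.
    apply: (@le_trans _ _ (s * W)); first by rewrite ler_peMr// ltW.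
    by rewrite sW; lra.
  have [p [Sp gp] pE] : exists2 p, L p &
      \sum_i (N^-1 - s * w 0 i) *: row i A = (1 - s) *: p.
    apply: convex_set_sum => //.
      move=> i; rewrite subr_ge0.
      have : `|w 0 i| <= W.
        by rewrite /W (bigD1 i)//= addrCA lerDl addr_ge0// sumr_ge0.
      move=> wW; have : s * w 0 i <= s * W.
        by rewrite ler_wpM2l ?(ltW s0)// (le_trans (ler_norm _)).
      by rewrite sW; lra.
    rewrite sumrB sumr_const card_ord -mulr_sumr -mulr_natl.
    have -> : m%:R = N - 1 :> R by rewrite NE -natr1 addrK.
    rewrite mulrBl mul1r divff ?gt_eqF//.
    have : - (\sum_i w 0 i) <= \sum_i `|w 0 i|.
      by rewrite -sumrN; apply: ler_sum => i _; rewrite -normrN ler_norm.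
    set X := \sum_i w 0 i => hX.
    have : s * (1 - X) <= s * W by rewrite ler_wpM2l ?(ltW s0)// lerD2l.
    rewrite sW; nra.
  have cz : c = s *: z + (1 - s) *: p.
    rewrite -pE -cE -{1}zE scaler_sumr -big_split/=; apply: eq_bigr => i _.
    by rewrite scalerA -scalerDl addrCA subrr addr0.
  have s01 : 0 <= s <= 1 by rewrite (ltW s0)/=; lra.
  have [_] := cg z p s Sz Sp s01.
  rewrite -cz => gcz.
  have h1 : - B <= s * g z.
    have : - `|g c| <= g c by rewrite lerNl -normrN ler_norm.
    rewrite /B; nra.
  have gz : - B * (2 * N * W) <= g z.
    by rewrite -ler_pdivlMr// mulrC.
  apply: le_trans gz; rewrite !mulNr lerN2 -!mulrA ler_wpM2l//.
  by rewrite ler_pM2l// ler_pM2l.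
exists (B * (2 * N) * (1 + K) * (1 + `|x0|)).
  apply: mulr_ge0; last exact: addr_ge0.
  apply: mulr_ge0; last exact: addr_ge0.
  by apply: mulr_ge0 => //; apply: mulr_ge0 => //; exact: ltW.
move=> y Dy; have Sy : S (y - x0) by rewrite /S /= addrCA subrr addr0.
have := key _ Sy; rewrite /g addrCA subrr addr0; apply: le_trans.
have : `|y - x0| <= `|y| + `|x0| by apply: ler_normB.
have E0 : 0 <= B * (2 * N) by rewrite !mulr_ge0// ltW.
set E : R := B * (2 * N) in E0 *; rewrite !mulNr lerN2 -!mulrA => h.
rewrite ler_wpM2l//.
have := normr_ge0 y; have := normr_ge0 x0; move: h.
set a := `|y - x0|; set b := `|y|; set e := `|x0| => h e0 b0.
have : K * a <= K * (b + e) by rewrite ler_wpM2l.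
have : 0 <= K * (b * e) by rewrite !mulr_ge0.
have : 0 <= b * e by rewrite !mulr_ge0.
nra.
Qed.

(** [S] is the conjugate of [G] and [g H] the limit of maximizing sequences. Testing [S K] with
    near-maximizers for [H] gives the lower bound; the quadratic decay of [dotp H J - G J] away from
    [g H] gives the upper one. *)
Lemma conjugate_quadratic_bounds (D : set 'rV[R]_d) (f : 'rV[R]_d -> R)
    (sigma : R) : 0 < sigma -> D !=set0 -> convex_on D f ->
  let G J := f J + sigma / 2 * dotp J J in
  exists (S : 'rV[R]_d -> R) (g : 'rV[R]_d -> 'rV[R]_d) (C : R),
    [/\ forall H J, D J -> dotp H J - G J <= S H,
        forall H e, 0 < e -> exists2 J, D J & S H - e < dotp H J - G J &
        forall H K, 0 <= S K - S H - dotp (K - H) (g H) <= C * `|K - H| ^+ 2].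
Proof.
move=> s0 D0 cf G.
have [C C0 fC] := convex_on_lower_bound cf.
have sq := @sqr_norm_le_dotp R d.
pose F H J := G J - dotp H J.
have s8 : 0 < sigma / 8 by rewrite divr_gt0.
(* The parallelogram identity for the term with [sigma / 2] produces the gain [sigma / 8]; the sup
   norm is below the Euclidean one. *)
have mid H J K : D J -> D K -> D (2^-1 *: (J + K)) /\
    F H (2^-1 *: (J + K)) <= (F H J + F H K) / 2 - sigma / 8 * `|J - K| ^+ 2.
  move=> DJ DK; have h : 0 <= (2^-1 : R) <= 1 by lra.
  have e : 1 - 2^-1 = 2^-1 :> R by lra.
  have [] := cf _ _ _ DJ DK h; rewrite e -scalerDr => h1 h2; split=> //.
  have := sq (J - K); rewrite /F /G !dotpE (dotpC K J) => h3.
  have : sigma / 8 * `|J - K| ^+ 2 <=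
    sigma / 8 * (dotp J J - dotp J K - (dotp J K - dotp K K)).
    by rewrite ler_pM2l//; lra.
  nra.
have low H : exists M, forall J, D J -> M <= F H J.
  pose E : R := C + d%:R * `|H|.
  (* This is the minimum over real [t] of [sigma / 2 * t ^+ 2 - E * t - C], to be used at
     [t = |J|]. *)
  exists (- C - E ^+ 2 / (2 * sigma)) => J DJ.
  have h1 := fC _ DJ; have := dotp_bound H J; rewrite ler_norml => /andP[_ h2].
  have h3 := sq J; rewrite /F /G.
  have h4 : sigma / 2 * `|J| ^+ 2 <= sigma / 2 * dotp J J.
    by rewrite ler_pM2l// divr_gt0.
  have : 0 <= (sigma * `|J| - E) ^+ 2 / (2 * sigma).
    by rewrite divr_ge0 ?sqr_ge0// mulr_ge0// ltW.
  have -> : (sigma * `|J| - E) ^+ 2 / (2 * sigma) =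
     sigma / 2 * `|J| ^+ 2 - E * `|J| + E ^+ 2 / (2 * sigma).
    by field; rewrite gt_eqF.
  have : E * `|J| = C * `|J| + d%:R * `|H| * `|J| by rewrite mulrDl.
  move: (E ^+ 2 / _) (E * _) => X Y -> hX; lra.
have ex H : exists p : R * 'rV[R]_d,
    (forall J, D J -> p.1 + 2 * (sigma / 8) * `|J - p.2| ^+ 2 <= F H J) /\
    (forall e, 0 < e -> exists2 J, D J & F H J < p.1 + e /\ `|p.2 - J| < e).
  have [M hM] := low H.
  have [mn [z h]] := midconvex_minimizing_limit s8 D0 (mid H) hM.
  by exists (mn, z).
have [p hp] := choice ex.
have S1 H J : D J -> dotp H J - G J <= - (p H).1.
  move=> /(hp H).1; rewrite /F => h.
  have : 0 <= 2 * (sigma / 8) * `|J - (p H).2| ^+ 2.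
    by rewrite !mulr_ge0 ?sqr_ge0// ltW.
  lra.
have S2 H e : 0 < e -> exists2 J, D J & - (p H).1 - e < dotp H J - G J.
  by move=> /(hp H).2[J DJ [h _]]; exists J => //; move: h; rewrite /F; lra.
exists (fun H => - (p H).1), (fun H => (p H).2), (d%:R ^+ 2 / sigma).
split=> // H K; apply/andP; split.
  apply/ler_addgt0Pr => e e0.
  pose N : R := d%:R * `|K - H| + 1.
  have N0 : 0 < N by rewrite ltr_wpDl// mulr_ge0.
  (* The defect of [J] and the error of replacing [g H] by [J] add up to at most
     [(d * |K - H| + 1) * (e / N)], which is [e]. *)
  have [J DJ [FJ zJ]] := (hp H).2 (e / N) (divr_gt0 e0 N0).
  have := S1 K J DJ; move: FJ; rewrite /F => h1 h2.
  have := dotp_bound (K - H) ((p H).2 - J); rewrite ler_norml => /andP[_ h3].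
  have h4 : d%:R * `|K - H| * `|(p H).2 - J| <= d%:R * `|K - H| * (e / N).
    by rewrite ler_wpM2l ?mulr_ge0// ltW.
  have h5 : d%:R * `|K - H| * (e / N) + e / N = e.
    by rewrite /N; field; rewrite gt_eqF.
  rewrite !dotpE in h3 *; lra.
apply/ler_addgt0Pr => e e0.
have [J DJ h] := S2 K e e0.
have := (hp H).1 J DJ; rewrite /F => h1.
have := dotp_bound (K - H) (J - (p H).2); rewrite ler_norml => /andP[_ h2].
(* Young's inequality: the linear term in [|J - g H|] is absorbed by the growth [sigma / 4], at the
   price of [d ^+ 2 / sigma * |K - H| ^+ 2]. *)
have : 0 <= (d%:R * `|K - H| - sigma / 2 * `|J - (p H).2|) ^+ 2 / sigma.
  by rewrite divr_ge0 ?sqr_ge0// ltW.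
have -> : (d%:R * `|K - H| - sigma / 2 * `|J - (p H).2|) ^+ 2 / sigma =
    d%:R ^+ 2 / sigma * `|K - H| ^+ 2 - d%:R * `|K - H| * `|J - (p H).2| +
     2 * (sigma / 8) * `|J - (p H).2| ^+ 2.
  by field; rewrite gt_eqF.
rewrite !dotpE in h2 *; lra.
Qed.

End convex_bounds.

(** * The co-energy density *)

(** Minus the infimum is the conjugate of [U x] plus a convex term, and subtracting
    [sigma / 2 |J|^2] from that sum leaves the convex [f]. The parabola below comes from the
    explicit term in [mu0] alone, as the conjugate lies above its tangents. *)
Lemma coenergy_quadratic_bounds (R : realType) d (mu0 sigma : R)
    (chi : 'rV[R]_d -> R) (Jp : 'rV[R]_d -> 'rV[R]_d)
    (U : 'rV[R]_d -> 'rV[R]_d -> \bar R) (x : 'rV[R]_d) :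
    0 <= mu0 -> 0 < sigma -> 0 <= chi x -> (forall J, U x J <> -oo%E) ->
    proper_fun (U x) -> strongly_convex sigma (U x) ->
  exists (w : 'rV[R]_d -> R) (g : 'rV[R]_d -> 'rV[R]_d) (C : R),
    (forall H, coenergy mu0 chi Jp U x H = (w H)%:E) /\
    forall H K, mu0 / 2 * dotp (K - H) (K - H) <= w K - w H - dotp (K - H) (g H)
      <= C * `|K - H| ^+ 2.
Proof.
move=> mu00 s0 c0 Uninf Uprop Ucvx.
pose D := edom (U x); pose u J := fine (U x J).
have UE J : D J -> U x J = (u J)%:E.
  move=> DJ; rewrite fineK// fin_numE; apply/andP; split; first exact/eqP.
  by rewrite -ltey.
pose f J := u J - sigma / 2 * enorm J ^+ 2 + chi x * enorm (J - Jp x).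
have cf : convex_on D f.
  move=> J K t DJ DK t01.
  have := Ucvx J K t t01; rewrite /= (UE _ DJ) (UE _ DK).
  set L := t *: J + (1 - t) *: K => h.
  (* The right side of [h] is finite, which rules out [U x L = +oo]. *)
  have DL : D L.
    rewrite /D /edom /=; move: h; case: (U x L) => [r| |]//.
    by move=> _; rewrite ltry.
  split=> //; move: h; rewrite (UE _ DL) -!EFinB -!EFinM -EFinD lee_fin /f => h.
  have := enorm_convex (J - Jp x) (K - Jp x) t01.
  have -> : t *: (J - Jp x) + (1 - t) *: (K - Jp x) = L - Jp x.
    rewrite !scalerDr addrACA -/L; congr (_ + _).
    by rewrite !scalerN -opprD -scalerDl (_ : t + (1 - t) = 1) ?scale1r//; ring.
  move=> h2; have : chi x * enorm (L - Jp x) <=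
      chi x * (t * enorm (J - Jp x) + (1 - t) * enorm (K - Jp x)).
    by rewrite ler_wpM2l.
  nra.
have [S [g [C [S1 S2 S3]]]] := conjugate_quadratic_bounds s0 Uprop cf.
have GE J : f J + sigma / 2 * dotp J J = u J + chi x * enorm (J - Jp x).
  by rewrite /f sqr_enorm; ring.
exists (fun H => mu0 / 2 * dotp H H + S H), (fun H => mu0 *: H + g H).
exists (mu0 / 2 * d%:R + C); split=> [H|H K].
  rewrite /coenergy sqr_enorm.
  suff -> : ereal_inf [set (U x J - (dotp H J)%:E +
      (chi x * enorm (J - Jp x))%:E)%E | J in setT] = (- S H)%:E.
    by rewrite EFinN oppeK.
  apply/eqP; rewrite eq_le; apply/andP; split.
    apply/lee_addgt0Pr => e e0; have [J DJ h] := S2 H e e0.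
    apply: ge_ereal_inf; exists (U x J - (dotp H J)%:E +
      (chi x * enorm (J - Jp x))%:E)%E; first by exists J.
    by rewrite UE// -EFinB -!EFinD lee_fin; move: h; rewrite GE; lra.
  apply: le_ereal_inf_tmp => _ [J _ <-].
  have [DJ|nDJ] := pselect (D J).
    rewrite UE// -EFinB -!EFinD lee_fin.
    by have := S1 H J DJ; rewrite GE; lra.
  have -> : U x J = +oo%E by apply/eqP; move/negP: nDJ; rewrite -leNgt leye_eq.
  by rewrite leey.
have := S3 H K => /andP[h1 h2].
have h3 : dotp (K - H) (K - H) <= d%:R * `|K - H| ^+ 2.
  by apply: le_trans (ler_norm _) _; rewrite expr2 mulrA dotp_bound.
have h4 : mu0 / 2 * dotp (K - H) (K - H) <= mu0 / 2 * (d%:R * `|K - H| ^+ 2).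
  by rewrite ler_wpM2l// divr_ge0.
have -> : mu0 / 2 * dotp K K + S K - (mu0 / 2 * dotp H H + S H) -
    dotp (K - H) (mu0 *: H + g H) =
    mu0 / 2 * dotp (K - H) (K - H) + (S K - S H - dotp (K - H) (g H)).
  by rewrite !dotpE (dotpC H K); field.
by apply/andP; split; lra.
Qed.

(** * Differentiability from a quadratic remainder *)

Lemma diff_quadratic_remainder (R : realType) (V : normedModType R)
    (f : V -> R^o) (L : {linear V -> R^o}) (x : V) (C : R) :
    continuous L ->
    (forall h, `|f (h + x) - f x - L h| <= C * `|h| ^+ 2) ->
  differentiable f x /\ 'd f x = L :> (V -> R).
Proof.
move=> Lc fC.
have fL : f \o shift x = cst (f x) + L +o_ 0 id.
  (* [C] may be zero or negative; a positive majorant allows the division below. *)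
  have C1 : 0 < Num.max C 1 by rewrite lt_max ltr01 orbT.
  apply/eqaddoP => _/posnumP[e]; near=> v.
  rewrite [X in `|X| <= _](_ : _ = f (v + x) - f x - L v); last first.
    by rewrite /= !fctE opprD addrA.
  apply: le_trans (fC v) _.
  apply: (@le_trans _ _ (Num.max C 1 * `|v| ^+ 2)).
    by apply: ler_wpM2r; rewrite ?sqr_ge0// le_max lexx.
  rewrite expr2 mulrA; apply: ler_wpM2r => //; rewrite mulrC -ler_pdivlMr//.
  by near: v; apply: nbhs0_le; rewrite divr_gt0.
have dE := diff_unique Lc fL.
by split=> //; apply/diff_locallyP; rewrite dE; split.
Unshelve. all: by end_near. Qed.

Section quadratic_expansion.
Context {R : realType} {d : nat}.
Variables (w : 'rV[R]_d -> R) (H g : 'rV[R]_d) (C : R).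
Hypothesis wC : forall K, `|w K - w H - dotp (K - H) g| <= C * `|K - H| ^+ 2.

Lemma quadratic_expansion_diff :
  differentiable (w : 'rV[R]_d -> R^o) H /\
  'd (w : 'rV[R]_d -> R^o) H = (fun v => dotp v g) :> ('rV[R]_d -> R).
Proof.
pose L : {linear 'rV[R]_d -> R^o} := HB.pack (fun v : 'rV[R]_d => dotp v g : R^o)
  (GRing.isLinear.Build R 'rV[R]_d R^o *:%R (fun v => dotp v g : R^o)
    (fun a u v => etrans (dotpDl _ _ _) (congr1 (+%R^~ (dotp v g)) (dotpZl _ _ _)))).
have Lc : continuous L.
  apply/linear_bounded_continuous/linear_boundedP.
  exists (d%:R * `|g|); split=> [|r /ltW rg v]; first exact: num_real.
  rewrite [L v]/=; apply: le_trans (dotp_bound _ _) _.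
  by rewrite mulrAC ler_wpM2r.
pose wo : 'rV[R]_d -> R^o := w.
have wL h : `|(w : 'rV[R]_d -> R^o) (h + H) - w H - L h| <= C * `|h| ^+ 2.
  by have := wC (h + H); rewrite addrK.
exact: diff_quadratic_remainder Lc wL.
Qed.

Lemma quadratic_expansion_grad : grad w H = g.
Proof.
have [wd dE] := quadratic_expansion_diff.
by apply/rowP => i; rewrite mxE deriveE// dE dotpC dotp_delta.
Qed.

End quadratic_expansion.

(** * Borel sets and Lebesgue measure on row vectors *)

Section lower_integral.
Import HBNNSimple.

(* No measurability is assumed: the integral is a supremum over the simple functions
   below the integrand, which can be cut off on a null set. *)
Lemma ae_eq_integral_lower d (T : measurableType d) (R : realType)
    (mu : {measure set T -> \bar R}) (D : set T) (f g : T -> \bar R) :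
  {ae mu, forall x, D x -> f x = g x} ->
  (\int[mu]_(x in D) f x = \int[mu]_(x in D) g x)%E.
Proof.
have le (f1 g1 : T -> \bar R) : (forall x, D x -> 0 <= f1 x)%E ->
    (forall x, D x -> 0 <= g1 x)%E ->
    {ae mu, forall x, D x -> f1 x = g1 x} ->
    (\int[mu]_(x in D) f1 x <= \int[mu]_(x in D) g1 x)%E.
  move=> f0 g0 [N [mN N0 fgN]].
  rewrite [leLHS]ge0_integralE//; apply: ge_ereal_sup => _ [h hf <-].
  rewrite -integralT_nnsfun (@ge0_negligible_integral _ _ _ _ _ N)//; last 2 first.
    by apply/measurable_EFinP.
    by move=> x _; rewrite lee_fin.
  have mN' : measurable (~` N) by exact: measurableC.
  rewrite setTD integral_nnsfun// ge0_integralE//; apply: ereal_sup_ubound.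
  exists (proj_nnsfun h mN'); last by rewrite mrestrict.
  move=> x; rewrite -(mrestrict h mN') /patch; case: ifPn => [|_]; last first.
    by rewrite /patch; case: ifPn => // /set_mem /g0.
  move=> /set_mem Nx; apply: le_trans (hf x) _; rewrite /patch; case: ifPn => // Dx.
  by rewrite (contra_notP (fgN x) Nx _)//; exact/set_mem.
have eq (f1 g1 : T -> \bar R) : (forall x, D x -> 0 <= f1 x)%E ->
    (forall x, D x -> 0 <= g1 x)%E ->
    {ae mu, forall x, D x -> f1 x = g1 x} ->
    (\int[mu]_(x in D) f1 x = \int[mu]_(x in D) g1 x)%E.
  move=> f0 g0 fg; apply/eqP; rewrite eq_le !le//.
  by apply: filterS fg => x h /h.
move=> fg; rewrite [LHS]integralE [RHS]integralE; congr (_ - _)%E; apply: eq => //;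
  by apply: filterS fg => x h /h; rewrite ?funeposE ?funenegE => ->.
Qed.

End lower_integral.

Section borel_rV.
Context {R : realType} {n : nat}.
Implicit Types (x y : 'rV[R]_n) (e : R) (O : set 'rV[R]_n).

(** Balls of the sup norm are boxes, which reduces their measurability and measure to the
    coordinates. *)
Lemma ball_rVE x e : 0 < e ->
  ball x e = [set y | forall i, (ball (x 0 i) e : set R) (y 0 i)].
Proof.
move=> e0; apply/seteqP; split=> y /=.
  by move=> [_ h] i; exact: h.
by move=> h; split=> // i j; rewrite (ord1 i); exact: h.
Qed.

Lemma measurable_ball_rV x e : 0 < e -> measurable (ball x e : set 'rV[R]_n).
Proof.
move=> e0.
have -> : ball x e = \bigcap_(i in [set: 'I_n])
    (fun y : 'rV[R]_n => y 0 i) @^-1` (ball (x 0 i) e).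
  by rewrite ball_rVE//; apply/seteqP; split=> y /= h i; [move=> _|]; exact: h.
apply: fin_bigcap_measurable => // i _.
rewrite -[X in measurable X]setTI; apply: measurable_coord => //.
exact: measurable_ball.
Qed.

Lemma lebesgue_ball_rV x e : 0 < e -> lebesgue_rV R n (ball x e) = ((2 * e) ^+ n)%:E.
Proof.
move=> e0; rewrite ball_rVE//.
rewrite [LHS](lebesgue_rV_box (A := fun i => ball (x 0 i) e)); last first.
  by move=> i; exact: measurable_ball.
rewrite (eq_bigr (fun=> (2 * e)%:E)); last first.
  by move=> i _; rewrite lebesgue_measure_ball ?ltW// mulr_natl.
by rewrite prodEFin prodr_const card_ord.
Qed.

(** The sigma-algebra is generated by the entries, so the topology enters through a countable cover:
    the balls inside [O] with rational centre and radius the inverse of a positive integer. *)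
Lemma open_measurable_rV O : open O -> measurable O.
Proof.
move=> oO.
pose B (p : 'rV[rat]_n * nat) : set 'rV[R]_n :=
  ball (map_mx (ratr : rat -> R) p.1) p.2.+1%:R^-1.
pose F p := if `[< B p `<=` O >] then B p else set0.
rewrite (_ : O = \bigcup_p F p).
  apply: countable_bigcupT_measurable => [|p]; first exact: countableP.
  rewrite /F; case: asboolP => // _; exact: measurable_ball_rV.
apply/seteqP; split=> [y Oy|y [p _]]; last first.
  by rewrite /F; case: asboolP => // BO; exact: BO.
have /nbhs_ballP[e /= e0 yO] : nbhs y O by exact: open_nbhs_nbhs.
have [k ke] : exists k : nat, k.+1%:R^-1 < e / 2.
  have [N _ /(_ N (leqnn N))] := near_infty_natSinv_lt (PosNum (divr_gt0 e0 (ltr0n _ 2))).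
  by exists N.
have k0 : 0 < k.+1%:R^-1 :> R by rewrite invr_gt0.
have ex i : exists q : rat, `|y 0 i - ratr q| < k.+1%:R^-1.
  have [|q] := @rat_in_itvoo R (y 0 i - k.+1%:R^-1) (y 0 i + k.+1%:R^-1).
    by rewrite ltrBlDr -addrA ltrDl addr_gt0.
  by rewrite in_itv/= -ltr_distl distrC => h; exists q.
have [q hq] := choice ex.
have qy : ball (map_mx (ratr : rat -> R) (\row_i q i)) k.+1%:R^-1 y.
  by rewrite ball_rVE//= => i; rewrite -ball_normE/= !mxE distrC.
exists (\row_i q i, k) => //; rewrite /F; case: asboolP => // nB; exfalso; apply: nB.
move=> z qz; apply: yO; rewrite (_ : e = e / 2 + e / 2); last by lra.
apply: ball_triangle (_ : ball (map_mx (ratr : rat -> R) (\row_i q i)) _ _).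
  by apply: ball_sym; apply: le_ball qy; exact: ltW.
by apply: le_ball qz; exact: ltW.
Qed.

Lemma open_continuous_measurable_rV O (f : 'rV[R]_n -> R) :
  open O -> {within O, continuous f} -> measurable_fun O f.
Proof.
move=> oO; rewrite continuous_open_subspace// => cf.
apply: (measurability _ (RGenOpens.measurableE R)) => _ [_ [a [b ->] <-]].
apply: open_measurable_rV; rewrite openE => x [Ox fx]; apply: filterI.
  exact: open_nbhs_nbhs.
apply: (cf x (mem_set Ox)); exact: open_nbhs_nbhs.
Qed.

Lemma lebesgue_open_gt0 O : open O -> O !=set0 -> (0 < lebesgue_rV R n O)%E.
Proof.
move=> oO [x Ox]; have /nbhs_ballP[e /= e0 xO] : nbhs x O by exact: open_nbhs_nbhs.
apply: (@lt_le_trans _ _ (lebesgue_rV R n (ball x e))).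
  by rewrite lebesgue_ball_rV// lte_fin exprn_gt0// mulr_gt0.
by apply: le_measure => //; rewrite inE;
  [exact: measurable_ball_rV|exact: open_measurable_rV].
Qed.

Lemma lebesgue_bounded_lty O : measurable O -> bounded_set O ->
  (lebesgue_rV R n O < +oo)%E.
Proof.
move=> mO [M [_ OM]].
have r0 : 0 < `|M| + 2 :> R by rewrite ltr_wpDl.
apply: (@le_lt_trans _ _ (lebesgue_rV R n (ball 0 (`|M| + 2)))); last first.
  by rewrite lebesgue_ball_rV// ltry.
apply: le_measure => //; rewrite ?inE//; first exact: measurable_ball_rV.
move=> x Ox; rewrite -ball_normE/= sub0r normrN.
apply: (@le_lt_trans _ _ (`|M| + 1)); last by rewrite ltrD2l ltr1n.
by apply: OM => //; apply: le_lt_trans (ler_norm _) _; rewrite ltrDl.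
Qed.

(** A nonempty open set has positive measure and so does not fit into a null set. *)
Lemma ae_dense O (P : 'rV[R]_n -> Prop) : open O -> O !=set0 ->
  {ae lebesgue_rV R n, forall x, P x} -> exists2 x, O x & P x.
Proof.
move=> oO O0 [N [mN N0 PN]]; apply: contrapT => h.
suff : (lebesgue_rV R n O <= lebesgue_rV R n N)%E.
  by rewrite N0 leNgt lebesgue_open_gt0.
apply: le_measure => //; rewrite ?inE//; first exact: open_measurable_rV.
by move=> x Ox; apply: PN => /= Px; apply: h; exists x.
Qed.

End borel_rV.

(** * Linearity of the finite element space *)

Section function_space_linearity.
Context {R : realType} {d : nat}.
Variable Om : set 'rV[R]_d.
Hypotheses (oOm : open Om) (bOm : bounded_set Om).
Local Notation leb := (lebesgue_rV R d).

Let mOm : measurable Om := open_measurable_rV oOm.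
Let fOm : (leb Om < +oo)%E := lebesgue_bounded_lty mOm bOm.

Lemma continuous_bounded_on (f : 'rV[R]_d -> R) :
  continuous f -> [bounded f x | x in Om].
Proof.
move=> cf; have [M [_ OmM]] := bOm.
pose K := [set x : 'rV[R]_d | `|x| <= M + 1].
have OmK : Om `<=` K by move=> x Ox; apply: OmM => //; rewrite ltrDl.
have cK : compact K.
  apply: bounded_closed_compact.
    exists (M + 1); split; first exact: num_real.
    by move=> N MN x /le_trans; apply; exact: ltW.
  rewrite (_ : K = Num.norm @^-1` [set r | r <= M + 1])//.
  by apply: closed_comp; [move=> ? _; exact: norm_continuous|exact: closed_le].
have /compact_bounded[N [Nr NP]] : compact (f @` K).
  by apply: continuous_compact => //; exact: continuous_subspaceT.
by exists N; split=> // y Ny x Ox; apply: NP => //; exists x => //; exact: OmK.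
Qed.

Lemma test_function_bounded phi : test_function Om phi ->
  measurable_fun Om phi /\ [bounded phi x | x in Om].
Proof.
move=> [/(_ 0%N) [cphi _] _]; split.
  by apply: open_continuous_measurable_rV => //; apply: continuous_subspaceW cphi.
by apply: continuous_bounded_on; apply/continuous_subspace_setT.
Qed.

Lemma test_function_grad_bounded phi i : test_function Om phi ->
  measurable_fun Om (fun x => grad phi x 0 i) /\
  [bounded grad phi x 0 i | x in Om].
Proof.
move=> [/(_ 1%N) [_ /(_ i) [_ [cphi _]]] _].
rewrite (_ : (fun x => grad phi x 0 i) = 'D_(delta_mx 0 i) (phi : 'rV[R]_d -> R^o)).
  split.
    by apply: open_continuous_measurable_rV => //; apply: continuous_subspaceW cphi.
  by apply: continuous_bounded_on; apply/continuous_subspace_setT.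
by apply/funext => x; rewrite mxE.
Qed.

Let bounded_cst1 : [bounded (cst 1 : 'rV[R]_d -> R) x | x in Om].
Proof. by exists 1; split=> // y y1 x _; rewrite /= normr1 ltW. Qed.

Lemma ae_eq_Rintegral (f g : 'rV[R]_d -> R) :
  {ae leb, forall x, Om x -> f x = g x} ->
  \int[leb]_(x in Om) f x = \int[leb]_(x in Om) g x.
Proof.
move=> fg; congr fine; apply: ae_eq_integral_lower.
by apply: filterS fg => x h /h ->.
Qed.

(** Passing to a Borel representative makes the additivity of the integral available. Integrability
    of [g] itself follows from [|g| <= 1 + g ^+ 2], since [Om] has finite measure. *)
Lemma L2_on_representative (f : 'rV[R]_d -> R) : L2_on Om f ->
  exists g : 'rV[R]_d -> R,
    [/\ measurable_fun Om g, {ae leb, forall x, Om x -> f x = g x},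
        leb.-integrable Om (EFin \o (fun x => g x ^+ 2)) &
        leb.-integrable Om (EFin \o g)].
Proof.
move=> [[g mg fg] ff]; exists g.
have mg2 : measurable_fun Om (fun x => g x ^+ 2) by exact: measurable_funX.
have ig2 : leb.-integrable Om (EFin \o (fun x => g x ^+ 2)).
  apply/integrableP; split; first exact/measurable_EFinP.
  under eq_integral do rewrite /= ger0_norm ?sqr_ge0//.
  rewrite -(@ae_eq_integral_lower _ _ _ _ _ (fun x => (f x ^+ 2)%:E))//.
  by apply: filterS fg => x h /h ->.
split=> //.
have i1 : leb.-integrable Om (EFin \o cst 1).
  by apply: measurable_bounded_integrable => //; exact: bounded_cst1.
apply: (le_integrable mOm _ _ (integrableD mOm i1 ig2)).
  exact/measurable_EFinP.
move=> x _ /=; rewrite lee_fin (@ger0_norm _ (1 + _)); last first.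
  by rewrite addr_ge0// sqr_ge0.
by rewrite ler_norml; apply/andP; split; nra.
Qed.

Lemma L2_on_lin (c : R) (f1 f2 : 'rV[R]_d -> R) :
  L2_on Om f1 -> L2_on Om f2 -> L2_on Om (fun x => f1 x + c * f2 x).
Proof.
move=> /L2_on_representative[g1 [m1 e1 i1 _]] /L2_on_representative[g2 [m2 e2 i2 _]].
have m12 : measurable_fun Om (fun x => g1 x + c * g2 x).
  by apply: measurable_funD => //; exact: measurable_funM.
have e12 : {ae leb, forall x, Om x -> f1 x + c * f2 x = g1 x + c * g2 x}.
  by apply: filterS2 e1 e2 => x h1 h2 Ox; rewrite h1// h2.
split; first by exists (fun x => g1 x + c * g2 x).
rewrite (@ae_eq_integral_lower _ _ _ _ _ _ (fun x => ((g1 x + c * g2 x) ^+ 2)%:E)).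
  have i12 : leb.-integrable Om (EFin \o (fun x => (g1 x + c * g2 x) ^+ 2)).
    (* The square of the sum is dominated by [2 * g1 ^+ 2 + 2 * c ^+ 2 * g2 ^+ 2]. *)
    apply: (le_integrable mOm _ _ (integrableD mOm (integrableZl mOm 2 i1)
      (integrableZl mOm (2 * c ^+ 2) i2))).
      by apply/measurable_EFinP; exact: measurable_funX.
    move=> x _ /=; rewrite lee_fin !ger0_norm ?sqr_ge0//.
      have := sqr_ge0 (g1 x - c * g2 x); nra.
    by have := sqr_ge0 (g1 x); have := mulr_ge0 (sqr_ge0 c) (sqr_ge0 (g2 x)); nra.
  have /integrableP[_] := i12.
  by under [X in (X < _)%E -> _]eq_integral do rewrite /= ger0_norm ?sqr_ge0//.
by apply: filterS e12 => x h /h ->.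
Qed.

(** The weight [h] will be a test function, one of its partial derivatives, or the constant 1 for
    the zero-mean condition. *)
Lemma Rintegral_L2_lin (c : R) (f1 f2 h : 'rV[R]_d -> R) :
  L2_on Om f1 -> L2_on Om f2 ->
  measurable_fun Om h -> [bounded h x | x in Om] ->
  \int[leb]_(x in Om) ((f1 x + c * f2 x) * h x) =
  \int[leb]_(x in Om) (f1 x * h x) + c * \int[leb]_(x in Om) (f2 x * h x).
Proof.
move=> /L2_on_representative[g1 [m1 e1 _ i1]] /L2_on_representative[g2 [m2 e2 _ i2]].
move=> mh bh.
have ih (g : 'rV[R]_d -> R) : leb.-integrable Om (EFin \o g) ->
    leb.-integrable Om (EFin \o (fun x => g x * h x)).
  by move=> ig; exact: (integrableMl mOm ig mh bh).
rewrite (@ae_eq_Rintegral _ (fun x => g1 x * h x + c * (g2 x * h x))); last first.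
  by apply: filterS2 e1 e2 => x h1 h2 Ox; rewrite h1// h2//; ring.
rewrite (@ae_eq_Rintegral (fun x => f1 x * h x) (fun x => g1 x * h x)); last first.
  by apply: filterS e1 => x h1 Ox; rewrite h1.
rewrite (@ae_eq_Rintegral (fun x => f2 x * h x) (fun x => g2 x * h x)); last first.
  by apply: filterS e2 => x h1 Ox; rewrite h1.
rewrite RintegralD//; [|exact: ih|exact: (integrableZl mOm c (ih _ i2))].
by rewrite RintegralZl//; exact: ih.
Qed.

Lemma H1_on_lin (c : R) (v1 v2 : 'rV[R]_d -> R) :
  H1_on Om v1 -> H1_on Om v2 -> H1_on Om (fun x => v1 x + c * v2 x).
Proof.
move=> [L1 [G1 LG1 wG1]] [L2 [G2 LG2 wG2]]; split; first exact: L2_on_lin.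
exists (fun x => G1 x + c *: G2 x) => [i|i phi tphi].
  by under eq_fun do rewrite !mxE; exact: L2_on_lin.
have [mg bg] := test_function_grad_bounded i tphi.
have [mp bp] := test_function_bounded tphi.
rewrite Rintegral_L2_lin// wG1// wG2//.
under [in RHS]eq_Rintegral do rewrite !mxE.
by rewrite Rintegral_L2_lin// mulrN opprD.
Qed.

Lemma Vh_lin (I : finType) (T : I -> 'I_d.+1 -> 'rV[R]_d) (c : R)
    (v1 v2 : 'rV[R]_d -> R) :
  Vh Om T v1 -> Vh Om T v2 -> Vh Om T (fun x => v1 x + c * v2 x).
Proof.
move=> [H1 c1 i1 a1] [H2 c2 i2 a2]; split.
- exact: H1_on_lin.
- move=> x; apply: cvgD; first exact: c1.
  by apply: cvgM; [exact: cvg_cst|exact: c2].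
- have := @Rintegral_L2_lin c v1 v2 (cst 1) (proj1 H1) (proj1 H2).
  under eq_Rintegral do rewrite mulr1.
  under [in RHS]eq_Rintegral do rewrite mulr1.
  under [in X in _ + _ * X]eq_Rintegral do rewrite mulr1.
  rewrite i1 i2 mulr0 addr0; apply.
    exact: measurable_cst.
  exact: bounded_cst1.
- move=> i; have [e1 [b1 h1]] := a1 i; have [e2 [b2 h2]] := a2 i.
  exists (e1 + c * e2), (b1 + c *: b2) => x Tx Ox.
  by rewrite h1// h2// !dotpE; ring.
Qed.

Lemma Vh0 (I : finType) (T : I -> 'I_d.+1 -> 'rV[R]_d) : Vh Om T (fun=> 0).
Proof.
split.
- split.
    split; first by exists (fun=> 0); [exact: measurable_cst|by apply: aeW].
    under eq_integral do rewrite expr0n/=.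
    by rewrite integral0 ltry.
  exists (fun=> 0) => [i|i phi _].
    split; first by exists (fun=> 0); [exact: measurable_cst|apply: aeW => x _; rewrite mxE].
    under eq_integral do rewrite mxE expr0n/=.
    by rewrite integral0 ltry.
  under eq_Rintegral do rewrite mul0r.
  under [in RHS]eq_Rintegral do rewrite mxE mul0r.
  by rewrite /Rintegral integral0 oppr0.
- by apply: continuous_subspaceT; exact: cst_continuous.
- by rewrite /Rintegral integral0.
- by move=> i; exists 0, 0 => x _ _; rewrite /dotp big1 ?addr0// => j _; rewrite mxE mul0r.
Qed.

End function_space_linearity.

(** * Simplices and Lipschitz domains *)

Lemma closure_approx (R : realType) (V : normedModType R) (A : set V) p e :
  closure A p -> 0 < e -> exists2 y, A y & `|p - y| < e.
Proof.
move=> Ap e0; have [y [Ay py]] := Ap _ (nbhsx_ballx p e e0).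
by exists y => //; move: py; rewrite -ball_normE.
Qed.

Lemma mulmx_norm_bound (R : realType) m n (A : 'M[R]_(m, n)) :
  exists2 K, 0 <= K & forall z : 'rV[R]_m,
    \sum_i `|(z *m A) 0 i| <= K * `|z| /\ `|z *m A| <= K * `|z|.
Proof.
exists (\sum_j \sum_i `|A i j|).
  by rewrite sumr_ge0// => j _; rewrite sumr_ge0.
move=> z.
have h j : `|(z *m A) 0 j| <= (\sum_i `|A i j|) * `|z|.
  rewrite mxE; apply: le_trans (ler_norm_sum _ _ _) _.
  rewrite mulr_suml; apply: ler_sum => i _.
  by rewrite normrM mulrC ler_wpM2l// mx_entry_le.
split; first by rewrite mulr_suml; apply: ler_sum => j _; exact: h.
apply: mx_norm_le.
  by rewrite mulr_ge0// sumr_ge0// => j _; rewrite sumr_ge0.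
move=> i j; rewrite (ord1 i); apply: le_trans (h j) _; rewrite ler_wpM2r//.
by rewrite (bigD1 j)//= lerDl sumr_ge0// => k _; rewrite sumr_ge0.
Qed.

Section simplex_geometry.
Context {R : realType} {d : nat}.
Variable v : 'I_d.+1 -> 'rV[R]_d.
Hypothesis vI : affinely_independent v.

(** The rows are the edges from vertex 0; affine independence makes this matrix invertible, so that
    [coord] below gives the barycentric coordinates of the other vertices. *)
Let E : 'M[R]_d := \matrix_(i, j) (v (lift ord0 i) - v ord0) 0 j.

Let row_E i : row i E = v (lift ord0 i) - v ord0.
Proof. by apply/rowP => j; rewrite !mxE. Qed.

Let E_unit : E \in unitmx.
Proof.
rewrite -row_free_unit; apply: inj_row_free => c cE.
pose l a := if unlift ord0 a is Some i then c 0 i else - \sum_i c 0 i.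
have l0 : l ord0 = - \sum_i c 0 i by rewrite /l unlift_none.
have lS i : l (lift ord0 i) = c 0 i by rewrite /l liftK.
have h1 : \sum_a l a = 0.
  by rewrite big_ord_recl l0 (eq_bigr _ (fun i _ => lS i)) addrC subrr.
have h2 : \sum_a l a *: v a = 0.
  rewrite big_ord_recl l0 scaleNr scaler_suml -sumrN -big_split/= -[RHS]cE.
  rewrite mulmx_sum_row; apply: eq_bigr => i _.
  by rewrite lS row_E scalerBr addrC.
by apply/rowP => i; rewrite mxE -lS; exact: vI h1 h2 _.
Qed.

Let coord x : 'rV[R]_d := (x - v ord0) *m invmx E.

Let coordP (c : 'rV[R]_d) (l : 'I_d.+1 -> R) :
  (forall i, l (lift ord0 i) = c 0 i) -> \sum_a l a = 1 ->
  coord (\sum_a l a *: v a) = c.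
Proof.
move=> lc l1; rewrite /coord -[RHS](mulmxK E_unit); congr (_ *m _).
rewrite mulmx_sum_row -[v ord0 in LHS]scale1r -l1 scaler_suml -sumrB.
rewrite big_ord_recl subrr add0r; apply: eq_bigr => i _.
by rewrite row_E lc scalerBr.
Qed.

Let coordK x : coord x *m E = x - v ord0.
Proof. by rewrite /coord mulmxKV. Qed.

Let simplexP x :
  simplex v x <-> (forall i, 0 <= coord x 0 i) /\ \sum_i coord x 0 i <= 1.
Proof.
split=> [[l [l0 l1 _ ->]]|[c0 c1]].
  have -> := @coordP (\row_i l (lift ord0 i)) l _ l1; last by move=> i; rewrite mxE.
  split=> [i|]; first by rewrite mxE.
  rewrite -l1 big_ord_recl (eq_bigr (fun i => l (lift ord0 i))); last first.
    by move=> i _; rewrite mxE.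
  by rewrite lerDr.
pose l a := if unlift ord0 a is Some i then coord x 0 i else 1 - \sum_i coord x 0 i.
have l0 : l ord0 = 1 - \sum_i coord x 0 i by rewrite /l unlift_none.
have lS i : l (lift ord0 i) = coord x 0 i by rewrite /l liftK.
exists l; split=> //.
- by move=> a; rewrite /l; case: unliftP => [i _|_] //; rewrite subr_ge0.
- by rewrite big_ord_recl l0 (eq_bigr _ (fun i _ => lS i)) subrK.
- by move=> a [].
- rewrite big_ord_recl l0 scalerBl scale1r scaler_suml -addrA [- _ + _]addrC -sumrB.
  rewrite -[LHS](subrK (v ord0)) -coordK mulmx_sum_row addrC; congr (_ + _).
  by apply: eq_bigr => i _; rewrite lS row_E scalerBr.
Qed.

Let coord_barycenter i : coord (barycenter v) 0 i = d.+1%:R^-1.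
Proof.
rewrite /barycenter scaler_sumr.
rewrite (@coordP (const_mx d.+1%:R^-1) (fun=> d.+1%:R^-1)) ?mxE//.
  by move=> j; rewrite mxE.
by rewrite sumr_const card_ord -[LHS]mulr_natl divff// pnatr_eq0.
Qed.

(** All barycentric coordinates equal [d.+1%:R^-1]. A perturbation of total size at most that number
    keeps them nonnegative and the sum of the last [d] at most 1. *)
Lemma barycenter_interior : interior (simplex v) (barycenter v).
Proof.
have [K K0 hK] := mulmx_norm_bound (invmx E).
have N0 : 0 < d.+1%:R^-1 :> R by rewrite invr_gt0.
have K1 : 0 < K + 1 by rewrite ltr_wpDl.
apply/nbhs_ballP; exists (d.+1%:R^-1 / (K + 1)); first exact: divr_gt0.
move=> x; rewrite -ball_normE/= => xb; apply/simplexP.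
pose z := (x - barycenter v) *m invmx E.
have cz i : coord x 0 i = d.+1%:R^-1 + z 0 i.
  rewrite -(coord_barycenter i) /coord /z -[in LHS](subrK (barycenter v) x).
  by rewrite -addrA addrC mulmxDl mxE.
have zs : \sum_i `|z 0 i| <= d.+1%:R^-1.
  apply: le_trans (hK _).1 _; rewrite -normrN opprB.
  apply: (@le_trans _ _ ((K + 1) * `|barycenter v - x|)).
    by rewrite ler_wpM2r// lerDl.
  by rewrite mulrC -ler_pdivlMr// ltW.
have zi i : `|z 0 i| <= d.+1%:R^-1.
  by apply: le_trans zs; rewrite (bigD1 i)//= lerDl sumr_ge0.
split=> [i|].
  by rewrite cz -lerBlDl sub0r; move: (zi i); rewrite ler_norml => /andP[].
rewrite (eq_bigr _ (fun i _ => cz i)) big_split/= sumr_const card_ord.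
rewrite -[_ *+ d]mulr_natl -lerBrDl; apply: le_trans (ler_norm _) _.
apply: le_trans (ler_norm_sum _ _ _) _; apply: le_trans zs _.
rewrite lerBrDl -{2}[d.+1%:R^-1]mul1r -mulrDl natr1 divff// pnatr_eq0.
Qed.

Lemma simplex_closed : closed (simplex v).
Proof.
have [K K0 hK] := mulmx_norm_bound (invmx E).
move=> x xS; apply/simplexP.
have near e : 0 < e -> exists2 y, simplex v y & forall z : 'rV[R]_d,
    z = (x - y) *m invmx E -> \sum_i `|z 0 i| <= e.
  move=> e0; have K1 : 0 < K + 1 by rewrite ltr_wpDl.
  have [y Sy xy] := closure_approx xS (divr_gt0 e0 K1).
  exists y => // z ->; apply: le_trans (hK _).1 _.
  apply: (@le_trans _ _ ((K + 1) * `|x - y|)); first by rewrite ler_wpM2r// lerDl.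
  by rewrite mulrC -ler_pdivlMr// ltW.
have cE y i : coord x 0 i = coord y 0 i + ((x - y) *m invmx E) 0 i.
  rewrite /coord -[in LHS](subrK y x) -addrA addrC mulmxDl mxE.
  by rewrite addrC.
split=> [i|]; apply/ler_addgt0Pr => e e0; have [y /simplexP[y0 y1] /(_ _ erefl) h] := near e e0.
  rewrite (cE y i) -addrA addr_ge0// -lerBlDr sub0r.
  have : `|((x - y) *m invmx E) 0 i| <= e.
    by apply: le_trans h; rewrite (bigD1 i)//= lerDl sumr_ge0.
  by rewrite ler_norml => /andP[].
rewrite (eq_bigr _ (fun i _ => cE y i)) big_split/= lerD//.
apply: le_trans (ler_norm _) _; apply: le_trans (ler_norm_sum _ _ _) _; exact: h.
Qed.

Lemma volume_gt0 : 0 < volume v.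
Proof.
have mS : measurable (simplex v).
  rewrite -[simplex v]setCK; apply: measurableC; apply: open_measurable_rV.
  exact: closed_openC simplex_closed.
have bS : bounded_set (simplex v).
  exists (\sum_a `|v a|); split=> [|M hM x]; first exact: num_real.
  move=> [l [l0 l1 _ ->]]; apply: le_trans (ltW hM).
  apply: le_trans (ler_norm_sum _ _ _) _; apply: ler_sum => a _.
  rewrite normrZ ler_piMl// ger0_norm// -l1 (bigD1 a)//= lerDl sumr_ge0//.
rewrite /volume fine_gt0// lebesgue_bounded_lty// andbT.
apply: lt_le_trans (lebesgue_open_gt0 (@open_interior _ (simplex v)) _) _.
  by exists (barycenter v); exact: barycenter_interior.
apply: le_measure => //; rewrite ?inE//; last exact: interior_subset.
by apply: open_measurable_rV; exact: open_interior.
Qed.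

End simplex_geometry.

Section lipschitz_domain.
Context {R : realType} {d : nat}.
Variable Om : set 'rV[R]_d.
Hypothesis lOm : lipschitz_boundary Om.

(* At a boundary point the downward direction of the local graph leaves
   [closure Om]. *)
Lemma interior_closure_lipschitz : interior (closure Om) `<=` Om.
Proof.
move=> p pi; apply: contrapT => nOp.
have [r [Q [k [g [r0 QQ [L gL] OmE]]]]] := lOm (interior_subset pi) nOp.
have [K K0 hK] := mulmx_norm_bound Q.
have gL' x y : `|g x - g y| <= `|L| * `|x - y|.
  have := gL (x, y) (conj I I) => /= /le_trans; apply.
  by rewrite ler_wpM2r// ler_norm.
have [K' K'0 hK'] := mulmx_norm_bound Q^T.
have /nbhs_ballP[e /= e0 pe] := pi.
(* The chart lives in a Euclidean ball while the estimates use the sup norm; the factor [d + 1]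
   dominates the square root of [d]. *)
have small z : `|z| < r / d.+1%:R -> enorm (z : 'rV[R]_d) < r.
  move=> zr; rewrite -(@ltr_pXn2r _ 2)// ?nnegrE ?sqrtr_ge0 ?(ltW r0)//.
  rewrite sqr_enorm; apply: le_lt_trans (ler_norm _) _.
  apply: le_lt_trans (dotp_bound _ _) _.
  have z0 := normr_ge0 z; rewrite ltr_pdivlMr ?ltr0n// in zr.
  have d0 : 0 <= d%:R :> R by [].
  have : (`|z| * d.+1%:R) ^+ 2 < r ^+ 2.
    by rewrite ltr_pXn2r// ?nnegrE ?(ltW r0)// mulr_ge0.
  rewrite -natr1; have : 0 <= `|z| ^+ 2 by rewrite sqr_ge0.
  have : 0 <= `|z| ^+ 2 * d%:R by rewrite mulr_ge0// sqr_ge0.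
  have : 0 <= `|z| ^+ 2 * d%:R ^+ 2 by rewrite mulr_ge0// sqr_ge0.
  nra.
(* A shift shorter than [rho] keeps [q] in the ball where [closure Om] is known, and uses at most
   half of the radius allowed by [small]. *)
pose rho : R := Num.min e (r / d.+1%:R / 2).
have rho0 : 0 < rho by rewrite lt_min e0 !divr_gt0.
pose t : R := rho / (K' + 1) / 2.
have K'1 : 0 < K' + 1 by rewrite ltr_wpDl.
have t0 : 0 < t by rewrite !divr_gt0.
pose z : 'rV[R]_d := t *: delta_mx 0 k *m Q^T.
have zn : `|z| < rho.
  apply: le_lt_trans (hK' _).2 _; rewrite normrZ gtr0_norm//.
  have d1 : `|delta_mx 0 k : 'rV[R]_d| <= 1.
    by apply: mx_norm_le => // i j; rewrite mxE; case: (_ && _); rewrite ?normr1 ?normr0.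
  have : t * `|delta_mx 0 k : 'rV[R]_d| <= t by rewrite ler_piMr// ltW.
  have tE : (K' + 1) * t = rho / 2 by rewrite /t; field; rewrite gt_eqF.
  move=> h; apply: (@le_lt_trans _ _ (K' * t)); first exact: ler_wpM2l.
  have : rho / 2 < rho by rewrite ltr_pdivrMr// ltr_pMr// ltr1n.
  by apply: le_lt_trans; rewrite -tE ler_wpM2r ?(ltW t0)// lerDl.
pose q := p - z.
have qc : closure Om q.
  apply: pe; rewrite -ball_normE/= /q opprB addrC subrK.
  by apply: lt_le_trans zn _; rewrite ge_min lexx.
have QQ' : Q^T *m Q = 1%:M by apply: mulmx1C.
have qQ : q *m Q = p *m Q - t *: delta_mx 0 k.
  by rewrite mulmxBl /z -mulmxA QQ' mulmx1.
have gp : (p *m Q) 0 k <= g (col' k (p *m Q)).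
  rewrite leNgt; apply/negP => h; apply: nOp; apply/OmE => //.
  by rewrite subrr; apply: small; rewrite normr0 divr_gt0.
have qk : (q *m Q) 0 k = (p *m Q) 0 k - t by rewrite qQ !mxE !eqxx mulr1.
have q' : col' k (q *m Q) = col' k (p *m Q).
  apply/matrixP => i j; rewrite qQ !mxE (ord1 i) eqxx/=.
  by rewrite [_ == k]eq_sym (negbTE (neq_lift _ _)) mulr0 subr0.
pose C : R := (`|L| + 1) * (K + 1).
have C0 : 0 < C by rewrite mulr_gt0// ltr_wpDl.
(* A point [y] of [Om] within [dl] of [q] changes the height and the graph value by less than
   [C * dl <= t] in total, while [q] lies at least [t] below the graph. *)
pose dl : R := Num.min (r / d.+1%:R / 2) (t / C).
have dl0 : 0 < dl by rewrite lt_min !divr_gt0.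
have [y Oy qy] := closure_approx qc dl0.
have yr : enorm (y - p) < r.
  apply: small; rewrite (_ : y - p = (y - q) - z); last first.
    by rewrite /q opprB addrA addrAC addrK.
  apply: le_lt_trans (ler_normB _ _) _; rewrite [ltRHS]splitr ltrD//.
    by rewrite distrC; apply: lt_le_trans qy _; rewrite ge_min lexx.
  by apply: lt_le_trans zn _; rewrite ge_min lexx orbT.
have := (OmE y yr).1 Oy => gy.
have yq : `|(y - q) *m Q| <= K * dl.
  apply: le_trans (hK _).2 _; rewrite ler_wpM2l// distrC ltW//.
have ent (A B : 'rV[R]_d) j : `|A 0 j - B 0 j| <= `|A - B|.
  by have := mx_entry_le (A - B) 0 j; rewrite !mxE.
rewrite mulmxBl in yq.
have yk : (y *m Q) 0 k <= (q *m Q) 0 k + K * dl.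
  rewrite -lerBlDl; apply: le_trans (le_trans (ent _ _ k) yq); exact: ler_norm.
have gg : g (col' k (q *m Q)) <= g (col' k (y *m Q)) + `|L| * (K * dl).
  rewrite -lerBlDl; apply: le_trans (ler_norm _) _; apply: le_trans (gL' _ _) _.
  rewrite ler_wpM2l//; apply: le_trans yq; apply: mx_norm_le => // i j.
  have colE (A B : 'rV[R]_d) : (col' k A - col' k B) i j = A 0 (lift k j) - B 0 (lift k j).
    by rewrite !mxE (ord1 i).
  by rewrite colE distrC; exact: ent.
have : C * dl <= t by rewrite mulrC -ler_pdivlMr// ge_min lexx orbT.
rewrite q' in gg; rewrite qk in yk.
have : 0 < dl * (`|L| + 1) by rewrite mulr_gt0// ltr_wpDl.
rewrite /C; nra.
Qed.

End lipschitz_domain.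

(** * Gradients of finite element functions *)

Section finite_element_gradients.
Context {R : realType} {d : nat}.
Variables (Om : set 'rV[R]_d) (I : finType) (T : I -> 'I_d.+1 -> 'rV[R]_d).
Hypotheses (oOm : open Om) (cOm : connected Om) (nOm : Om !=set0)
  (bOm : bounded_set Om).
Hypothesis cover : Om `<=` \bigcup_i simplex (T i).
Hypothesis intT : forall i, interior (simplex (T i)) (barycenter (T i)).
Hypothesis baryOm : forall i, Om (barycenter (T i)).
Local Notation leb := (lebesgue_rV R d).

Lemma grad_affine_near (f : 'rV[R]_d -> R) x a b :
  (\forall y \near x, f y = a + dotp b y) -> grad f x = b.
Proof.
move=> fE; rewrite -(@quadratic_expansion_grad _ _ (fun y => a + dotp b y) x b 0).
  apply/rowP => i; rewrite !mxE.
  exact: (@near_eq_derive _ _ _ (f : 'rV[R]_d -> R^o) (fun y => a + dotp b y : R^o)).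
move=> K; rewrite mul0r !dotpE (dotpC K b) (dotpC x b).
by rewrite (_ : _ - _ = 0) ?normr0//; ring.
Qed.

(** The barycenter is interior to both the element and [Om], so the affine formula holds on a full
    neighbourhood and determines [grad]. *)
Lemma Vh_near_affine v i : Vh Om T v -> exists a b,
  (forall x, simplex (T i) x -> Om x -> v x = a + dotp b x) /\
  (\forall x \near barycenter (T i), v x = a + dotp b x).
Proof.
move=> [_ _ _ /(_ i)[a [b h]]]; exists a, b; split=> //.
by apply: filterS2 (intT i) (open_nbhs_nbhs (conj oOm (baryOm i))).
Qed.

Lemma Vh_affine v i : Vh Om T v -> exists a, forall x, simplex (T i) x -> Om x ->
  v x = a + dotp (grad v (barycenter (T i))) x.
Proof.
by move=> /Vh_near_affine-/(_ i)[a [b [h1 /grad_affine_near ->]]]; exists a.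
Qed.

Lemma grad_Vh_lin c v1 v2 i : Vh Om T v1 -> Vh Om T v2 ->
  grad (fun x => v1 x + c * v2 x) (barycenter (T i)) =
  grad v1 (barycenter (T i)) + c *: grad v2 (barycenter (T i)).
Proof.
move=> /Vh_near_affine-/(_ i)[a1 [b1 [_ h1]]] /Vh_near_affine-/(_ i)[a2 [b2 [_ h2]]].
rewrite (grad_affine_near h1) (grad_affine_near h2).
apply: (@grad_affine_near _ _ (a1 + c * a2)).
by apply: filterS2 h1 h2 => x -> ->; rewrite !dotpE; ring.
Qed.

(** The image is connected, and in a finite set of reals each singleton is relatively open and
    closed. *)
Lemma connected_finite_image_cst (f : 'rV[R]_d -> R) :
  {within Om, continuous f} -> finite_set (f @` Om) ->
  exists c, forall x, Om x -> f x = c.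
Proof.
move=> cf fin; have [x0 Ox0] := nOm; exists (f x0) => x Ox.
have fincl (A : set R) : finite_set A -> closed A.
  move: A; apply/(@accessible_finite_set_closed R); apply: hausdorff_accessible.
  exact: Rhausdorff.
have fOm : [set f x0] = f @` Om; last first.
  have : (f @` Om) (f x) by exists x.
  by rewrite -fOm.
apply: (connected_continuous_connected cOm cf).
- by exists (f x0).
- exists (~` (f @` Om `\` [set f x0])).
    by apply: closed_openC; apply: fincl; apply: sub_finite_set fin => y [].
  apply/seteqP; split=> y /=.
    by move=> ->; split; [exists x0|case].
  by move=> [fy h]; apply: contrapT => yx; apply: h.
- exists [set f x0]; first by apply: fincl; exact: finite_set1.
  by apply/seteqP; split=> y /=; [move=> ->; split=> //; exists x0|case].
Qed.

(** The difference is constant on each element, hence takes finitely many values; this replaces any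
    argument about adjacent elements. *)
Lemma Vh_grad_inj v1 v2 : Vh Om T v1 -> Vh Om T v2 ->
  (forall i, grad v1 (barycenter (T i)) = grad v2 (barycenter (T i))) ->
  forall x, Om x -> v1 x = v2 x.
Proof.
move=> V1 V2 g12.
pose u x := v1 x + (-1) * v2 x.
have Vu : Vh Om T u by exact: Vh_lin.
have gu i : grad u (barycenter (T i)) = 0.
  by rewrite grad_Vh_lin// g12 scaleN1r subrr.
have ex i : exists a, forall x, simplex (T i) x -> Om x -> u x = a.
  have [a h] := Vh_affine i Vu; exists a => x Tx Ox; rewrite h// gu /dotp big1 ?addr0//.
  by move=> j _; rewrite mxE mul0r.
have [a ha] := choice ex.
have [_ cu iu _] := Vu.
have fin : finite_set (u @` Om).
  apply: (@sub_finite_set _ _ (range a)); last exact/finite_image/finite_finset.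
  by move=> _ [x Ox <-]; have [i _ Ti] := cover Ox; exists i => //; rewrite (ha i).
have [c uc] := connected_finite_image_cst cu fin.
have c0 : c = 0.
  have mOm := open_measurable_rV oOm.
  move: iu; rewrite (@eq_Rintegral _ _ _ _ _ (cst c)); last first.
    by move=> x /set_mem; exact: uc.
  rewrite Rintegral_cst// => /eqP; rewrite mulf_eq0 => /orP[/eqP//|].
  rewrite gt_eqF// fine_gt0// lebesgue_open_gt0//=.
  exact: lebesgue_bounded_lty.
by move=> x /uc; rewrite c0 /u mulN1r => /subr0_eq.
Qed.

End finite_element_gradients.

(** * Passage to the limit at a barycenter *)

Section almost_everywhere_limits.
Context {R : realType} {d : nat}.
Variables (Om : set 'rV[R]_d) (x : 'rV[R]_d).
Hypothesis Omx : nbhs x Om.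

(** This makes the neighbourhoods of [x] restricted to the good set a proper filter, along which
    inequalities pass to the limit. *)
Lemma ae_closure (G : 'rV[R]_d -> Prop) :
  {ae lebesgue_rV R d, forall y, G y} -> closure G x.
Proof.
move=> aeG B nB.
have B0 : (interior B) !=set0 by exists x; exact: nbhs_singleton (nbhs_interior nB).
have [y By Gy] := ae_dense (@open_interior _ B) B0 aeG.
by exists y; split=> //; exact: interior_subset.
Qed.

Lemma ae_limit_ge0 (f : 'rV[R]_d -> R) : {for x, continuous f} ->
  {ae lebesgue_rV R d, forall y, Om y -> 0 <= f y} -> 0 <= f x.
Proof.
move=> fx aef; have FF := within_nbhs_proper (ae_closure aef).
apply: (cvgr_to_ge (cvg_within_filter _ fx)); rewrite near_withinE.
by near=> y; apply; near: y.
Unshelve. all: by end_near. Qed.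

Lemma ae_limit_strongly_convex (sigma : R) (U : 'rV[R]_d -> 'rV[R]_d -> \bar R) :
    (forall J, {for x, continuous (U ^~ J)}) -> (forall J, U x J <> -oo%E) ->
    {ae lebesgue_rV R d, forall y, Om y -> strongly_convex sigma (U y)} ->
  strongly_convex sigma (U x).
Proof.
move=> Ux Uninf aeU J K t t01; have FF := within_nbhs_proper (ae_closure aeU).
set F := within _ _ in FF.
have cvU L : (U y L - (sigma / 2 * enorm L ^+ 2)%:E)%E @[y --> F] -->
    (U x L - (sigma / 2 * enorm L ^+ 2)%:E)%E.
  apply: cvgeB; [exact: fin_num_adde_defl|exact: cvg_within_filter (Ux L)|].
  exact: cvg_cst.
(* The two limits on the right must not be opposite infinities; excluding [-oo] suffices. The case
   [s = 0] is separate because [0 * +oo = 0]. *)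
have ninf L s : 0 <= s ->
    (s%:E * (U x L - (sigma / 2 * enorm L ^+ 2)%:E))%E \in [pred y | -oo < y]%E.
  rewrite inE /= ltNye => s0; have := Uninf L; case: (U x L) => [r||]// _.
  rewrite le_eqVlt in s0; case/predU1P: s0 => [<-|s0]; first by rewrite mul0e.
  by rewrite addye// gt0_muley ?lte_fin.
have [t0 t1] := andP t01; have t1' : 0 <= 1 - t by rewrite subr_ge0.
have lhs := cvU (t *: J + (1 - t) *: K).
have rhs := @cvgeD _ F (@filter_filter _ F FF) _ _ _ _ _ (ltninfty_adde_def (ninf J t t0) (ninf K _ t1'))
  (cvgeZl (isT : t%:E \is a fin_num) (cvU J))
  (cvgeZl (isT : (1 - t)%:E \is a fin_num) (cvU K)).
rewrite -(cvg_lim _ lhs)// -(cvg_lim _ rhs)//; apply: lee_lim.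
- by apply/cvg_ex; eexists; exact: lhs.
- by apply/cvg_ex; eexists; exact: rhs.
rewrite /F near_withinE; near=> y => Gy; apply: Gy => //.
by near: y.
Unshelve. all: by end_near. Qed.

End almost_everywhere_limits.

(** * Minimization over gradient tuples *)

Lemma mxvec_norm_le (R : realType) m n (M : 'M[R]_(m, n)) : `|mxvec M| <= `|M|.
Proof.
apply: mx_norm_le => // i k; rewrite (ord1 i).
by case/mxvec_indexP: k => a b; rewrite mxvecE; exact: mx_entry_le.
Qed.

(** In finite dimension [D] is the kernel of multiplication by the cokernel matrix of a spanning
    family, and that map is continuous. *)
Lemma linear_set_closed (R : realType) m n (D : set 'M[R]_(m, n)) :
  D 0 -> (forall c A B, D A -> D B -> D (A + c *: B)) -> closed D.
Proof.
move=> D0 Dl z zD.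
have [p [A [DA AD]]] := row_span_of_set [set v | D (vec_mx v)].
have DE b : (mxvec b <= A)%MS -> D b.
  move=> /submxP[w wE]; rewrite -(mxvecK b) wE mulmx_sum_row linear_sum /=.
  apply: (big_ind D) => // [x y Dx Dy|i _].
    by rewrite -[y]scale1r; exact: (Dl).
  by rewrite linearZ -[X in D X]add0r; apply: (Dl) => //; exact: DA.
apply: DE; have [K K0 hK] := mulmx_norm_bound (cokermx A).
rewrite submxE; apply/eqP; apply/eqP; rewrite -normr_le0; apply/ler_addgt0Pr => e e0.
have K1 : 0 < K + 1 by rewrite ltr_wpDl.
have [b Db zb] := closure_approx zD (divr_gt0 e0 K1).
have /eqP b0 : mxvec b *m cokermx A == 0 by rewrite -submxE AD//= mxvecK.
rewrite add0r -[X in `|X|]subr0 -b0 -mulmxBl -linearB.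
apply: le_trans (hK _).2 _; apply: (@le_trans _ _ ((K + 1) * `|z - b|)).
  by rewrite ler_pM// ?lerDl// mxvec_norm_le.
by rewrite mulrC -ler_pdivlMr// ltW.
Qed.

Lemma weighted_sum_minimizer (R : realType) n d (D : set 'M[R]_(n, d)) (mu0 : R)
    (w : 'I_n -> 'rV[R]_d -> R) (g : 'I_n -> 'rV[R]_d -> 'rV[R]_d)
    (vol : 'I_n -> R) (h : 'I_n -> 'rV[R]_d) :
    D 0 -> (forall c A B, D A -> D B -> D (A + c *: B)) ->
    0 < mu0 -> (forall k, 0 < vol k) ->
    (forall k H K, mu0 / 2 * dotp (K - H) (K - H) <=
       w k K - w k H - dotp (K - H) (g k H)) ->
  let F b := \sum_k w k (h k - row k b) * vol k in
  exists c z, [/\ 0 < c, D z & forall b, D b -> F z + c * `|b - z| ^+ 2 <= F b].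
Proof.
move=> D0 Dl mu00 vol0 wg F.
(* [V^-1] bounds all weights from below; the summand 1 covers the empty sum. *)
pose V := 1 + \sum_k (vol k)^-1.
have sv : 0 <= \sum_k (vol k)^-1 by rewrite sumr_ge0// => k _; rewrite invr_ge0 ltW.
have V0 : 0 < V by rewrite ltr_wpDr.
have volV k : V^-1 <= vol k.
  rewrite -[leRHS]invrK lef_pV2 ?posrE ?invr_gt0//.
  rewrite /V (bigD1 k)//= addrCA lerDl addr_ge0// sumr_ge0// => j _.
  by rewrite invr_ge0 ltW.
pose c := mu0 / 8 * V^-1.
have c0 : 0 < c by rewrite mulr_gt0 ?invr_gt0// divr_gt0.
have midF J K : D J -> D K -> D (2^-1 *: (J + K)) /\
    F (2^-1 *: (J + K)) <= (F J + F K) / 2 - c * `|J - K| ^+ 2.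
  move=> DJ DK; split.
    rewrite -[X in D X]add0r; apply: (Dl) => //.
    by rewrite -[K]scale1r; exact: (Dl).
  have cle : c * `|J - K| ^+ 2 <=
      \sum_k mu0 / 8 * dotp (row k J - row k K) (row k J - row k K) * vol k.
    have t0 k : 0 <= mu0 / 8 * dotp (row k J - row k K) (row k J - row k K) * vol k.
      by rewrite !mulr_ge0 ?dotp_ge0 ?ltW.
    have [->|] := eqVneq `|J - K| 0; first by rewrite expr0n mulr0 sumr_ge0.
    move=> /mx_norm_neq0[[k j]] /= JKE; rewrite [`|J - K|]JKE -normrX ger0_norm ?sqr_ge0//.
    rewrite (bigD1 k)//= -[leLHS]addr0 lerD ?sumr_ge0//.
    apply: (@le_trans _ _ (c * dotp (row k J - row k K) (row k J - row k K))).
      rewrite ler_pM2l// /dotp (bigD1 j)//= !mxE -expr2 lerDl.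
      by rewrite sumr_ge0// => i _; rewrite -expr2 sqr_ge0.
    rewrite /c mulrAC ler_wpM2l// mulr_ge0 ?dotp_ge0// ltW// divr_gt0//.
  apply: (@le_trans _ _ ((F J + F K) / 2 -
    \sum_k mu0 / 8 * dotp (row k J - row k K) (row k J - row k K) * vol k)); last first.
    by rewrite lerD2l lerN2.
  rewrite /F -big_split/= mulr_suml -sumrB; apply: ler_sum => k _.
  rewrite [(_ + _) / 2]mulrC -mulrDl mulrA -mulrBl ler_wpM2r ?(ltW (vol0 k))//.
  set HJ := h k - row k J; set HK := h k - row k K.
  have HM : h k - row k (2^-1 *: (J + K)) = 2^-1 *: (HJ + HK).
    by apply/rowP => j; rewrite !mxE; lra.
  have e1 : row k J - row k K = HK - HJ.
    by rewrite /HK /HJ opprB [RHS]addrC addrA subrK.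
  rewrite HM e1; clearbody HJ HK; set M := 2^-1 *: (HJ + HK).
  have hJ : HJ - M = 2^-1 *: (HJ - HK) by apply/rowP => j; rewrite !mxE; lra.
  have hK' : HK - M = (- 2^-1) *: (HJ - HK) by apply/rowP => j; rewrite !mxE; lra.
  clearbody M; clear HM e1.
  (* The tangent inequalities at the midpoint [M] are averaged: the linear terms cancel and the
     halved difference leaves [mu0 / 8]. *)
  have := wg k M HJ; have := wg k M HK; rewrite hJ hK' !dotpZl !dotpZr !dotpE.
  by rewrite (dotpC HK HJ); lra.
(* The tangent parabola at 0 is bounded below by completing the square. *)
have lowF J : D J -> \sum_k (w k 0 - dotp (g k 0) (g k 0) / (2 * mu0)) * vol k <= F J.
  move=> _; apply: ler_sum => k _; rewrite ler_wpM2r ?(ltW (vol0 k))//.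
  have := wg k 0 (h k - row k J); rewrite subr0; set H := h k - row k J; clearbody H.
  have := dotp_ge0 (mu0 *: H + g k 0) => /(mulr_ge0 (ltW _ : 0 <= (2 * mu0)^-1)).
  rewrite invr_gt0 mulr_gt0// => /(_ isT).
  have -> : (2 * mu0)^-1 * dotp (mu0 *: H + g k 0) (mu0 *: H + g k 0) =
     mu0 / 2 * dotp H H + dotp H (g k 0) + dotp (g k 0) (g k 0) / (2 * mu0).
    by rewrite !dotpE (dotpC (g k 0) H); field; rewrite gt_eqF.
  lra.
have [mn [z [zF zD]]] := midconvex_minimizing_limit c0 (ex_intro _ 0 D0) midF lowF.
have Dz : D z.
  apply: (linear_set_closed D0 Dl) => B /nbhs_ballP[e /= e0 zB].
  have [J DJ [_ zJ]] := zD e e0; exists J; split=> //; apply: zB.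
  by rewrite -ball_normE.
exists (2 * c), z; split=> //; first by rewrite mulr_gt0.
(* Attainment at [z] needs semicontinuity: the tangent bound at [z] gives
   [F z - F J <= B * |z - J|], used with [J] near [z] and [F J] near [mn]. *)
suff Fz : F z <= mn by move=> b /zF; apply: le_trans; rewrite lerD2r.
apply/ler_addgt0Pr => e e0.
pose B := \sum_k d%:R * `|g k (h k - row k z)| * vol k.
have B0 : 0 <= B by rewrite sumr_ge0// => k _; rewrite !mulr_ge0// ltW.
have B1 : 0 < B + 1 by rewrite ltr_wpDl.
have [J DJ [FJ zJ]] := zD (e / (B + 1)) (divr_gt0 e0 B1).
have : F z - F J <= B * `|z - J|.
  rewrite /F -sumrB /B mulr_suml; apply: ler_sum => k _.
  rewrite -mulrBl [leRHS]mulrAC ler_wpM2r ?(ltW (vol0 k))//.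
  have := wg k (h k - row k z) (h k - row k J).
  have -> : h k - row k J - (h k - row k z) = row k z - row k J.
    by rewrite opprB addrC addrA subrK.
  have := dotp_ge0 (row k z - row k J) => /(mulr_ge0 (ltW _ : 0 <= mu0 / 2)).
  rewrite divr_gt0// => /(_ isT).
  have := dotp_bound (row k z - row k J) (g k (h k - row k z)).
  rewrite ler_norml => /andP[+ _].
  have : d%:R * `|row k z - row k J| * `|g k (h k - row k z)| <=
      d%:R * `|g k (h k - row k z)| * `|z - J|.
    rewrite mulrAC ler_wpM2l ?mulr_ge0//; apply: mx_norm_le => // i j.
    by apply: le_trans (mx_entry_le _ k j); rewrite !mxE.
  lra.
have : B * `|z - J| + e / (B + 1) <= e.
  have : B * `|z - J| <= B * (e / (B + 1)) by rewrite ler_wpM2l// ltW.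
  have : B * (e / (B + 1)) + e / (B + 1) = e by field; rewrite gt_eqF.
  lra.
lra.
Qed.

(** * The discrete problem *)

Section discrete_problem.
Context {R : realType} {d : nat}.
Variables (Om : set 'rV[R]_d) (I : finType) (T : I -> 'I_d.+1 -> 'rV[R]_d).
Hypotheses (oOm : open Om) (cOm : connected Om) (nOm : Om !=set0)
  (bOm : bounded_set Om).
Hypothesis cover : Om `<=` \bigcup_i simplex (T i).
Hypothesis affT : forall i, affinely_independent (T i).
Hypothesis baryOm : forall i, Om (barycenter (T i)).
Variables (wx : 'rV[R]_d -> 'rV[R]_d -> \bar R) (Hs : 'rV[R]_d -> 'rV[R]_d).
Variables (mu0 : R) (w : I -> 'rV[R]_d -> R) (g : I -> 'rV[R]_d -> 'rV[R]_d)
  (C : I -> R).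
Hypothesis mu0_gt0 : 0 < mu0.
Hypothesis wxE : forall i H, wx (barycenter (T i)) H = (w i H)%:E.
Hypothesis w_bounds : forall i H K,
  mu0 / 2 * dotp (K - H) (K - H) <= w i K - w i H - dotp (K - H) (g i H)
    <= C i * `|K - H| ^+ 2.

Local Notation x_ i := (barycenter (T i)).

Let intT i : interior (simplex (T i)) (x_ i) := barycenter_interior (@affT i).
Let vol0 i : 0 < volume (T i) := volume_gt0 (@affT i).
Let arg v i : 'rV[R]_d := Hs (x_ i) - grad v (x_ i).

Let w_expansion i H K : `|w i K - w i H - dotp (K - H) (g i H)| <= C i * `|K - H| ^+ 2.
Proof.
have /andP[h1 h2] := w_bounds i H K; rewrite ger0_norm//.
by apply: le_trans h1; rewrite mulr_ge0 ?dotp_ge0// divr_ge0// ltW.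
Qed.

Let fine_wx i : fine \o wx (x_ i) = w i.
Proof. by apply/funext => H; rewrite /= wxE. Qed.

Let W v : R := \sum_i w i (arg v i) * volume (T i).

Let quad_hE v : quad_h T (fun x => wx x (Hs x - grad v x)) = (W v)%:E.
Proof. by rewrite /quad_h -sumEFin; apply: eq_bigr => i _; rewrite wxE. Qed.

Let ip_hE psi v : ip_h T (fun x => grad (fine \o wx x) (Hs x - grad psi x)) (grad v) =
  \sum_i dotp (g i (arg psi i)) (grad v (x_ i)) * volume (T i).
Proof.
by apply: eq_bigr => i _; rewrite fine_wx (quadratic_expansion_grad (w_expansion i _)).
Qed.

Let minimizesE psi : minimizes_discrete Om T wx Hs psi <->
  Vh Om T psi /\ forall v, Vh Om T v -> W psi <= W v.
Proof.
by split=> -[Vpsi h]; split=> // v /h; rewrite !quad_hE lee_fin.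
Qed.

Let arg_lin psi v c i : Vh Om T psi -> Vh Om T v ->
  arg (fun x => psi x + c * v x) i = arg psi i - c *: grad v (x_ i).
Proof. by move=> Vpsi Vv; rewrite /arg (grad_Vh_lin oOm intT baryOm)// opprD addrA. Qed.

Lemma solves_minimizes psi :
  solves_discrete Om T wx Hs psi <-> minimizes_discrete Om T wx Hs psi.
Proof.
rewrite minimizesE; split.
  move=> [Vpsi _ sol]; split=> // v Vv.
  (* Tested with [psi - v], the equation cancels the linear term of the tangent bound at [psi]. *)
  have := sol _ (Vh_lin oOm bOm (-1) Vpsi Vv); rewrite ip_hE => sol0.
  rewrite -subr_ge0 -sol0 /W -sumrB; apply: ler_sum => i _.
  rewrite -mulrBl ler_wpM2r ?(ltW (vol0 i))// (grad_Vh_lin oOm intT baryOm)//.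
  have /andP[+ _] := w_bounds i (arg psi i) (arg v i).
  have -> : arg v i - arg psi i = grad psi (x_ i) + -1 *: grad v (x_ i).
    by rewrite /arg opprB addrC addrA subrK scaleN1r.
  set z := grad psi _ + _; rewrite (dotpC z).
  have : 0 <= mu0 / 2 * dotp z z by rewrite mulr_ge0 ?dotp_ge0// divr_ge0// ltW.
  lra.
move=> [Vpsi minW]; split=> // [i x|v Vv].
  split; first by apply: filterE => H; rewrite wxE.
  by rewrite fine_wx; exact: (quadratic_expansion_diff (w_expansion i _)).1.
rewrite ip_hE; set a := \sum_i _.
pose b := \sum_i C i * `|grad v (x_ i)| ^+ 2 * volume (T i).
(* Minimality against [psi + s v] and the upper parabola; a nonzero [a] would make this negative for
   a small [s] of its sign. *)
have key s : 0 <= - s * a + s ^+ 2 * b.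
  have := minW _ (Vh_lin oOm bOm s Vpsi Vv); rewrite -subr_ge0 => /le_trans; apply.
  rewrite /W -sumrB /a /b !mulr_sumr -big_split; apply: ler_sum => i _ /=.
  rewrite !mulrA -mulrBl -mulrDl ler_wpM2r ?(ltW (vol0 i))// arg_lin//.
  have /andP[_] := w_bounds i (arg psi i) (arg psi i - s *: grad v (x_ i)).
  have -> : arg psi i - s *: grad v (x_ i) - arg psi i = - (s *: grad v (x_ i)).
    by rewrite addrAC subrr add0r.
  rewrite normrN normrZ exprMn real_normK ?num_real// dotpNl dotpZl.
  by rewrite (dotpC (grad v _)); lra.
apply/eqP; apply: contraT => a0.
pose B := `|b| + 1.
(* With [B > b], the choice [s = a / B] gives [- s ^+ 2 * (B - b)], negative unless [a = 0]. *)
have B0 : 0 < B by rewrite ltr_wpDl.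
have := key (a / B).
have -> : - (a / B) * a + (a / B) ^+ 2 * b = - (a / B) ^+ 2 * (B - b).
  by field; rewrite gt_eqF.
rewrite mulNr oppr_ge0 leNgt mulr_gt0//.
  by rewrite exprn_even_gt0// mulf_neq0// invr_eq0 gt_eqF.
by rewrite subr_gt0; apply: le_lt_trans (ler_norm b) _; rewrite ltrDl.
Qed.

Lemma exists_unique_minimizer : exists psi,
  unique_on Om (minimizes_discrete Om T wx Hs) psi.
Proof.
pose Gm (v : 'rV[R]_d -> R) : 'M[R]_(#|I|, d) := \matrix_(k, j) grad v (x_ (enum_val k)) 0 j.
have Gm_lin c u v : Vh Om T u -> Vh Om T v ->
    Gm (fun x => u x + c * v x) = Gm u + c *: Gm v.
  by move=> Vu Vv; apply/matrixP => k j; rewrite [LHS]mxE (grad_Vh_lin oOm intT baryOm)// !mxE.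
pose D := [set Gm v | v in Vh Om T].
have D0 : D 0.
  exists (fun=> 0); first exact: Vh0.
  apply/matrixP => k j; rewrite mxE [RHS]mxE (@grad_affine_near _ _ _ _ 0 0) ?mxE//.
  by apply: filterE => x; rewrite add0r /dotp big1// => i _; rewrite mxE mul0r.
have Dl c A B : D A -> D B -> D (A + c *: B).
  move=> [u Vu <-] [v Vv <-]; exists (fun x => u x + c * v x); last exact: Gm_lin.
  exact: Vh_lin.
have [c [z [c0 [psi Vpsi psiz] zmin]]] :=
  weighted_sum_minimizer (w := fun k => w (enum_val k)) (g := fun k => g (enum_val k))
    (vol := fun k : 'I_#|I| => volume (T (enum_val k)))
    (fun k => Hs (x_ (enum_val k))) D0 Dl mu0_gt0 (fun k => vol0 (enum_val k))
    (fun k H K => proj1 (andP (w_bounds (enum_val k) H K))).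
have FW v : \sum_k w (enum_val k) (Hs (x_ (enum_val k)) - row k (Gm v)) *
    volume (T (enum_val k)) = W v.
  rewrite /W (reindex_onto (@enum_val I I) enum_rank) /=; last first.
    by move=> i _; rewrite enum_rankK.
  apply: eq_big => [k|k _]; first by rewrite enum_valK eqxx.
  by congr (w _ (_ - _) * _); apply/rowP => j; rewrite !mxE.
have Wmin v : Vh Om T v -> W psi + c * `|Gm v - z| ^+ 2 <= W v.
  by move=> Vv; rewrite -2!FW psiz; apply: zmin; exists v.
exists psi; split.
  apply/minimizesE; split=> // v /Wmin; apply: le_trans; rewrite lerDl.
  by rewrite mulr_ge0 ?sqr_ge0// ltW.
move=> phi /minimizesE[Vphi minphi].
(* Two minimizers have equal energy, so the growth around [z] forces equal gradient tuples. *)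
have : c * `|Gm phi - z| ^+ 2 <= 0.
  by have := Wmin _ Vphi; have := minphi _ Vpsi; lra.
rewrite pmulr_rle0// real_exprn_even_le0//= ?num_real// normr_eq0 subr_eq0 => /eqP Gz.
apply: (Vh_grad_inj oOm cOm nOm bOm cover intT baryOm) => // i.
have /matrixP Gi : Gm phi = Gm psi by rewrite Gz psiz.
by apply/rowP => j; have := Gi (enum_rank i) j; rewrite !mxE enum_rankK.
Qed.

End discrete_problem.

(** * From almost everywhere data to the barycenters *)

Theorem theorem10 (R : realType) (d : nat) (hd : d = 2%N \/ d = 3%N)
    (Om : set 'rV[R]_d) (hOm : bounded_domain Om) (hLip : lipschitz_boundary Om)
    (hball : homeomorphic Om unit_ball)
    (mu0 : R) (hmu0 : 0 < mu0)
    (chi : 'rV[R]_d -> R) (hchi : Linfty_on Om chi)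
    (hchi0 : {ae lebesgue_rV R d, forall x, Om x -> 0 <= chi x})
    (Jp : 'rV[R]_d -> 'rV[R]_d)
    (U : 'rV[R]_d -> 'rV[R]_d -> \bar R)
    (hUninf : forall x J, Om x -> U x J <> -oo%E)
    (hUmeas : exists2 V : 'rV[R]_d * 'rV[R]_d -> \bar R,
        measurable_fun (Om `*` setT) V &
        {ae lebesgue_rV R d, forall x, Om x -> forall J, U x J = V (x, J)})
    (sigma : R) (hsigma : 0 < sigma)
    (hU : {ae lebesgue_rV R d, forall x, Om x ->
        [/\ proper_fun (U x), closed_fun (U x), strongly_convex sigma (U x) &
            C2_on_dom (U x)]})
    (Hs : 'rV[R]_d -> 'rV[R]_d) (js : 'rV[R]_d -> 'rV[R]_(curl_dim d))
    (hjs : Hcurl_on Om Hs js)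
    (I : finType) (T : I -> 'I_d.+1 -> 'rV[R]_d)
    (hT : conforming_partition Om T)
    (hchi_pw : piecewise_continuous T chi)
    (hU_pw : forall J, piecewise_continuous T (fun x => U x J))
    (hHs_pw : piecewise_continuous T Hs)
    (hU_bary : forall i, proper_fun (U (barycenter (T i)))) :
  exists psi : 'rV[R]_d -> R,
    unique_on Om (solves_discrete Om T (coenergy mu0 chi Jp U) Hs) psi /\
    unique_on Om (minimizes_discrete Om T (coenergy mu0 chi Jp U) Hs) psi.
Proof.
have [oOm cOm nOm bOm] := hOm; have [affT _ closT _] := hT.
have intT i := barycenter_interior (@affT i).
have cover : Om `<=` \bigcup_i simplex (T i) by rewrite -closT; exact: subset_closure.
have baryOm i : Om (barycenter (T i)).
  (* The mesh covers [closure Om], so a barycenter is at first only interior to the closure. *)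
  apply: (interior_closure_lipschitz hLip); apply: filterS (intT i) => x Tx.
  by rewrite closT; exists i.
have pw (S : topologicalType) (f : 'rV[R]_d -> S) i :
    piecewise_continuous T f -> {for barycenter (T i), continuous f}.
  move=> /(_ i); rewrite continuous_open_subspace; last exact: open_interior.
  by apply; rewrite inE.
have ex i : exists p : ('rV[R]_d -> R) * ('rV[R]_d -> 'rV[R]_d) * R,
    (forall H, coenergy mu0 chi Jp U (barycenter (T i)) H = (p.1.1 H)%:E) /\
    forall H K, mu0 / 2 * dotp (K - H) (K - H) <=
      p.1.1 K - p.1.1 H - dotp (K - H) (p.1.2 H) <= p.2 * `|K - H| ^+ 2.
  have nOmi : nbhs (barycenter (T i)) Om by exact: open_nbhs_nbhs.
  have Uninf J : U (barycenter (T i)) J <> -oo%E by exact: hUninf.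
  have chi0 : 0 <= chi (barycenter (T i)).
    by apply: (ae_limit_ge0 nOmi) => //; exact: pw.
  have Uconv : strongly_convex sigma (U (barycenter (T i))).
    apply: (ae_limit_strongly_convex nOmi) => //.
      by move=> J; apply: (pw _ (U ^~ J)); exact: hU_pw.
    by apply: filterS hU => x h /h[].
  (* Properness can be lost in the limit, since the values at a fixed [J] may tend to [+oo]; at the
     barycenter it comes from [hU_bary]. *)
  have [w [g [C [wE wb]]]] := coenergy_quadratic_bounds Jp (ltW hmu0) hsigma chi0
    Uninf (hU_bary i) Uconv.
  by exists (w, g, C).
have [p hp] := choice ex.
have wE i := (hp i).1; have wb i := (hp i).2.
have [psi min] := exists_unique_minimizer oOm cOm nOm bOm cover affT baryOm Hs hmu0 wE wb.
have eqv := solves_minimizes oOm bOm affT baryOm Hs hmu0 wE wb.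
exists psi; split=> //; have [mpsi upsi] := min.
by split; [exact/eqv|move=> phi /eqv; exact: upsi].
Qed.
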